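(* Let $\pi:\tau\to\Delta_\ell(d)$ be a degree $d$ Cayley structure on a face $\tau$ of $\mathcal{A}$. Then $\deg C_{\pi,\mathbf{f}}=d$ for general choice of $\mathbf{f}$ if and only if $\pi$ is primitive. If $\pi$ is imprimitive, then (for general $\mathbf{f}$) $C_{\pi,\mathbf{f}}=C_{\mathrm{Red}(\pi)}$ and $\deg C_{\pi,\mathbf{f}}$ is the degree of $\mathrm{Red}(\pi)$.
   Context: **Toric varieties.** $\mathbb{K}$ is an algebraically closed field of characteristic zero, $M\cong\mathbb{Z}^n$ a lattice, $\mathcal{A}\subset M$ finite. $X_\mathcal{A}=\mathrm{Proj}\,\mathbb{K}[S_\mathcal{A}]\subseteq\mathbb{P}^{\#\mathcal{A}-1}$, where $S_\mathcal{A}\subset M\times\mathbb{Z}$ is the semigroup generated by $(u,1)$, $u\in\mathcal{A}$. A face $\tau$ of $\mathcal{A}$ is the intersection of $\mathcal{A}$ with a face of $\mathrm{conv}\,\mathcal{A}$ ($\mathcal{A}$ is a face of itself). $X_\tau\subseteq X_\mathcal{A}$ is embedded by $x_u=0$ for $u\notin\tau$. For a subset $\mathcal{B}$ of a lattice, $\langle\mathcal{B}\rangle$ is the sublattice generated by differences of its elements, and $\dim\mathcal{B}$ is its rank. **Cayley structures.** $\Delta_\ell(d)=\{u\in\mathbb{Z}_{\geq0}^{\ell+1}: u_0+\dots+u_\ell=d\}$. A Cayley structure of length $\ell$ and degree $d$ on $\tau$ is a non-constant affine-linear map $\pi:\tau\to\Delta_\ell(d)$ such that for every $i\in\{0,\dots,\ell\}$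 there are $w,w'\in\pi(\tau)$ with $w_i=0$ and $w'_i\neq0$. $\pi$ is imprimitive if either $\dim\pi(\tau)=1$ and $\ell>1$, or $\ell=1$ and $\langle\pi(\tau)\rangle\subset m\mathbb{Z}^2$ for some $m>1$; otherwise primitive. For $\pi$ imprimitive with image $\mathcal{B}$ (so $\dim\mathcal{B}=1$), let $d'$ be the lattice length of $\mathrm{conv}\,\mathcal{B}$ with respect to $\langle\mathcal{B}\rangle$. Up to transposing $e_0,e_1$ there is a unique affine-linear inclusion $\mathcal{B}\to\Delta_1(d')$ [taking the endpoints of $\mathrm{conv}\,\mathcal{B}$ to $d'e_0,d'e_1$]. The reduction of $\pi$ is the composition $\mathrm{Red}(\pi):\tau\to\mathcal{B}\to\Delta_1(d')$, a primitive Cayley structure of degree $d'$, well-defined up to equivalence (permutation of coordinates). **Curves.** For a tuple $\mathbf{f}=(f_0,\dots,f_\ell)$ of nonzero linear forms in $\mathbb{K}[y_0,y_1]$ put $\mathbf{f}^v=\prod_i f_i^{v_i}$. $C_{\pi,\mathbf{f}}\subseteq X_\tau$ is the closure of the image of $\mathbb{P}^1\dashrightarrow X_\tau\subseteq\mathbb{P}^{\#\mathcal{A}-1}$, $y\mapsto(\mathbf{f}^{\pi(u)}(y))_{u\in\mathcal{A}}$ (coordinate $0$ for $u\notin\tau$). If $\pi$ has length $1$, $C_{\pi,\mathbf{f}}$ does not depend on $\mathbf{f}$ as long as its entries have distinct roots, and is written $C_\pi$. Degree is degree of the (reduced) curve in $\mathbb{P}^{\#\mathcal{A}-1}$. *)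

(* Defs.v *)
From HB Require Import structures.
From mathcomp Require Import all_boot all_order all_algebra.
From mathcomp Require Import finmap.
From mathcomp Require Import mpoly.

Set Implicit Arguments.
Unset Strict Implicit.
Unset Printing Implicit Defensive.

Import Order.TTheory GRing.Theory Num.Theory.
Local Open Scope fset_scope.
Local Open Scope ring_scope.

(* A lattice of rank [n] is ['rV[int]_n].  Convexity takes place in
   ['rV[rat]_n]: the faces of a lattice polytope are cut out by rational
   hyperplanes, so nothing changes with real coefficients. *)

Definition toQ (n : nat) (u : 'rV[int]_n) : 'rV[rat]_n :=
  map_mx (fun z : int => z%:~R) u.

Definition conv (n : nat) (S : {fset 'rV[int]_n}) (x : 'rV[rat]_n) : Prop :=
  exists c : 'rV[int]_n -> rat,
    [/\ forall u, 0 <= c u,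
        \sum_(u <- S) c u = 1
      & x = \sum_(u <- S) c u *: toQ u].

(* [a = 0] gives [P] itself. *)
Definition polytope_face (n : nat) (P F : 'rV[rat]_n -> Prop) : Prop :=
  exists (a : 'cV[rat]_n) (b : rat),
    (forall x, P x -> (x *m a) 0 0 <= b) /\
    (forall x, F x <-> P x /\ (x *m a) 0 0 = b).

Definition is_face (n : nat) (A tau : {fset 'rV[int]_n}) : Prop :=
  exists F : 'rV[rat]_n -> Prop,
    polytope_face (conv A) F /\
    (forall u, u \in tau <-> u \in A /\ F (toQ u)).

(* The sublattice generated by the differences of elements of [B]. *)
Definition diff_lattice (n : nat) (B : {fset 'rV[int]_n}) (w : 'rV[int]_n) :
    Prop :=
  exists c : 'rV[int]_n -> 'rV[int]_n -> int,
    w = \sum_(u <- B) \sum_(v <- B) (u - v) *~ c u v.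

(* The rank of [diff_lattice B] is the dimension of its rational span. *)
Definition lattice_dim (n : nat) (B : {fset 'rV[int]_n}) : nat :=
  \dim <<[seq toQ (u - v) | u <- B, v <- B]>>%VS.

(* [f] is the restriction to [S] of an affine-linear map of rational vector
   spaces, i.e. it respects the affine relations between elements of [S].
   No integral extension to the whole lattice is required: the differences of
   elements of [S] may generate a sublattice that is not saturated. *)
Definition affine_on (n m : nat) (S : {fset 'rV[int]_n})
    (f : 'rV[int]_n -> 'rV[int]_m) : Prop :=
  exists (L : 'M[rat]_(n, m)) (b : 'rV[rat]_m),
    forall u, u \in S -> toQ (f u) = toQ u *m L + b.

Definition in_simplex (l d : nat) (u : 'rV[int]_l.+1) : Prop :=
  (forall i, 0 <= u 0 i) /\ \sum_i u 0 i = d%:Z.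

Definition img (n m : nat) (tau : {fset 'rV[int]_n})
    (pi : 'rV[int]_n -> 'rV[int]_m) : {fset 'rV[int]_m} :=
  [fset pi u | u in tau].

(* Only the values of [pi] on [tau] are relevant. *)
Definition cayley (n l d : nat) (tau : {fset 'rV[int]_n})
    (pi : 'rV[int]_n -> 'rV[int]_l.+1) : Prop :=
  [/\ forall u, u \in tau -> in_simplex d (pi u),
      affine_on tau pi,
      exists u v, [/\ u \in tau, v \in tau & pi u != pi v]
    & forall i : 'I_l.+1,
        (exists2 w, w \in img tau pi & w 0 i = 0) /\
        (exists2 w, w \in img tau pi & w 0 i != 0)].

Definition imprimitive (n l : nat) (tau : {fset 'rV[int]_n})
    (pi : 'rV[int]_n -> 'rV[int]_l.+1) : Prop :=
  (lattice_dim (img tau pi) = 1%N /\ (1 < l)%N) \/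
  (l = 1%N /\
   exists2 m : nat, (1 < m)%N &
     forall w, diff_lattice (img tau pi) w -> forall i, (m%:Z %| w ord0 i)%Z).

Definition primitive (n l : nat) (tau : {fset 'rV[int]_n})
    (pi : 'rV[int]_n -> 'rV[int]_l.+1) : Prop :=
  ~ imprimitive tau pi.

(* For [B] of dimension 1: [p] and [q] are the endpoints of the segment
   [conv B], and its length is [d] times a generator of [diff_lattice B]. *)
Definition lattice_segment (n : nat) (B : {fset 'rV[int]_n})
    (p q : 'rV[int]_n) (d : nat) : Prop :=
  [/\ p \in B, q \in B,
      forall x, conv B x <-> conv [fset p; q] x
    & exists g : 'rV[int]_n,
        (forall w, diff_lattice B w <-> exists k : int, w = g *~ k) /\
        q - p = g *+ d].

(* [pi'] is the reduction of [pi], of degree [d'].  This is a relation because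
   the reduction is only defined up to exchanging the two coordinates;
   see [reduction_exists] below. *)
Definition is_reduction (n l : nat) (tau : {fset 'rV[int]_n})
    (pi : 'rV[int]_n -> 'rV[int]_l.+1) (d' : nat)
    (pi' : 'rV[int]_n -> 'rV[int]_2) : Prop :=
  exists (p q : 'rV[int]_l.+1) (rho : 'rV[int]_l.+1 -> 'rV[int]_2),
    let B := img tau pi in
    [/\ lattice_segment B p q d',
        [/\ affine_on B rho,
            {in B &, injective rho}
          & forall w, w \in B -> in_simplex d' (rho w)],
        rho p = d'%:Z *: delta_mx 0 0,
        rho q = d'%:Z *: delta_mx 0 1
      & forall u, u \in tau -> pi' u = rho (pi u)].

(* Points of projective space are nonzero row vectors up to scaling, and
   subsets of projective space are scaling-invariant predicates on nonzero
   vectors. *)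

Definition same_point (K : fieldType) (N : nat) (x y : 'rV[K]_N) : Prop :=
  exists2 c : K, c != 0 & x = c *: y.

(* Over an infinite field, a nonempty Zariski-open subset of affine space
   contains the nonvanishing locus of a nonzero polynomial, and conversely. *)
Definition generic (K : fieldType) (N : nat) (P : 'rV[K]_N -> Prop) : Prop :=
  exists2 G : {mpoly K[N]}, G != 0 &
    forall v : 'rV[K]_N, G.@[v 0] != 0 -> P v.

Definition zariski_closure (K : fieldType) (N : nat) (S : 'rV[K]_N -> Prop)
    (x : 'rV[K]_N) : Prop :=
  x != 0 /\
  forall (k : nat) (p : {mpoly K[N]}), p \is k.-homog ->
    (forall s : 'rV[K]_N, S s -> p.@[s 0] = 0) -> p.@[x 0] = 0.

(* The degree of a reduced projective curve: the number of its points on a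
   general hyperplane. *)
Definition curve_degree (K : fieldType) (N : nat) (C : 'rV[K]_N -> Prop)
    (d : nat) : Prop :=
  generic (fun a : 'rV[K]_N => a != 0 ->
    let H (x : 'rV[K]_N) := \sum_i a 0 i * x 0 i = 0 in
    exists s : 'I_d -> 'rV[K]_N,
      [/\ forall i, C (s i) /\ H (s i),
          forall i j, same_point (s i) (s j) -> i = j
        & forall x, C x -> H x -> exists i, same_point x (s i)]).

(* A tuple of linear forms in two variables is the matrix whose rows are the
   coefficient vectors. *)
Definition lform (K : fieldType) (m : nat) (f : 'M[K]_(m, 2)) (i : 'I_m)
    (y : 'rV[K]_2) : K :=
  f i 0 * y 0 0 + f i 1 * y 0 1.

Definition nonzero_forms (K : fieldType) (m : nat) (f : 'M[K]_(m, 2)) : Prop :=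
  forall i, row i f != 0.

Definition distinct_roots (K : fieldType) (m : nat) (f : 'M[K]_(m, 2)) : Prop :=
  forall i j, i != j ->
    forall y : 'rV[K]_2, y != 0 -> lform f i y = 0 -> lform f j y != 0.

Definition general_forms (K : fieldType) (m : nat) (P : 'M[K]_(m, 2) -> Prop) :
    Prop :=
  generic (fun v : 'rV[K]_(m * 2) =>
    let f : 'M[K]_(m, 2) := vec_mx v in nonzero_forms f -> P f).

(* Homogeneous coordinates are indexed by [A] through its enumeration.  On a
   Cayley structure the entries of [pi u] are nonnegative, so that [absz] is
   just the conversion to [nat]. *)
Definition curve_param (K : fieldType) (n l : nat) (A tau : {fset 'rV[int]_n})
    (pi : 'rV[int]_n -> 'rV[int]_l.+1) (f : 'M[K]_(l.+1, 2)) (y : 'rV[K]_2) :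
    'rV[K]_#|` A| :=
  \row_k let u := nth 0 (enum_fset A) k in
         if u \in tau then \prod_i lform f i y ^+ absz (pi u 0 i) else 0.

Arguments curve_param {K n l} A tau pi f y.

Definition curve (K : fieldType) (n l : nat) (A tau : {fset 'rV[int]_n})
    (pi : 'rV[int]_n -> 'rV[int]_l.+1) (f : 'M[K]_(l.+1, 2)) :
    'rV[K]_#|` A| -> Prop :=
  zariski_closure (fun x => x != 0 /\
    exists2 y : 'rV[K]_2, y != 0 & x = curve_param A tau pi f y).

Arguments curve {K n l} A tau pi f _.

(* The remaining lemmas lead to [reduction_exists]. *)

Lemma mulrz_mxE (m : nat) (x : 'rV[int]_m) (k : int) i :
  (x *~ k) 0 i = x 0 i * k.
Proof. by rewrite -scaler_int !mxE intz mulrC. Qed.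

Definition on_line (m : nat) (i : 'I_m) (e x : 'rV[int]_m) : Prop :=
  x *~ e 0 i = e *~ x 0 i.

Lemma on_lineD (m : nat) (i : 'I_m) (e x y : 'rV[int]_m) (a b : int) :
  on_line i e x -> on_line i e y -> on_line i e (x *~ a + y *~ b).
Proof.
rewrite /on_line => hx hy.
rewrite mxE !mulrz_mxE mulrzDr mulrzDl -!mulrzA.
by rewrite [a * _]mulrC [b * _]mulrC !mulrzA hx hy.
Qed.

Lemma on_line_inj (m : nat) (i : 'I_m) (e x y : 'rV[int]_m) :
  e 0 i != 0 -> on_line i e x -> on_line i e y -> x 0 i = y 0 i -> x = y.
Proof.
rewrite /on_line => e0 hx hy hxy.
have : x *~ e 0 i = y *~ e 0 i by rewrite hx hy hxy.
move=> /rowP h; apply/rowP => j; have := h j.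
by rewrite !mulrz_mxE => /(mulIf e0).
Qed.

Lemma line_generator (m : nat) (i : 'I_m) (e : 'rV[int]_m)
    (D : 'rV[int]_m -> 'rV[int]_m) (s : seq 'rV[int]_m) :
  e 0 i != 0 -> uniq s -> (forall u, u \in s -> on_line i e (D u)) ->
  exists (g : 'rV[int]_m) (c : 'rV[int]_m -> int),
    [/\ g = \sum_(u <- s) D u *~ c u, on_line i e g &
        forall u, u \in s -> exists k : int, D u = g *~ k].
Proof.
move=> e0; elim: s => [_ _|a s IH /= /andP[nas us] hs].
  exists 0, (fun=> 0); split=> //; first by rewrite big_nil.
  by rewrite /on_line mxE mul0rz mulr0z.
have [|g [c [Eg og hg]]] := IH us.
  by move=> u hu; apply: hs; rewrite inE hu orbT.
have oa : on_line i e (D a) by apply: hs; rewrite inE eqxx.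
have [u [v Euv]] := Bezoutz (D a 0 i) (g 0 i).
set G := gcdz _ _ in Euv.
pose g' := D a *~ u + g *~ v.
have og' : on_line i e g' by exact: on_lineD.
have g'i : g' 0 i = G by rewrite mxE !mulrz_mxE -Euv mulrC [g 0 i * v]mulrC.
have key x : on_line i e x -> (G %| x ord0 i)%Z -> exists k : int, x = g' *~ k.
  move=> ox dx; exists (x ord0 i %/ G)%Z.
  apply: (on_line_inj e0 ox).
    by have := on_lineD (x ord0 i %/ G)%Z 0 og' og'; rewrite mulr0z addr0.
  by rewrite mulrz_mxE g'i mulrC divzK.
exists g', (fun x => if x == a then u else c x * v); split=> //.
  rewrite big_cons eqxx /g' Eg mulrz_suml; congr (_ + _).
  rewrite !big_seq; apply: eq_bigr => x xs.
  by case: eqP nas => [<-|_ _]; [rewrite xs|rewrite mulrzA].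
move=> x; rewrite inE => /orP[/eqP->|/hg[k ->]].
  by apply: key => //; apply: dvdz_gcdl.
have [|k' Ek'] := key g og; first exact: dvdz_gcdr.
by exists (k' * k); rewrite {1}Ek' mulrzA.
Qed.

Lemma seq_min (T : eqType) (f : T -> int) (s : seq T) (x0 : T) :
  x0 \in s -> exists2 p, p \in s & forall w, w \in s -> f p <= f w.
Proof.
elim: s x0 => // a s IH _ _.
case: s IH => [_|b s /(_ b) []]; first by exists a; rewrite ?inE // => w; rewrite inE => /eqP->.
  by rewrite inE eqxx.
move=> p ps hp; case: (lerP (f a) (f p)) => hap.
  exists a; rewrite ?inE ?eqxx // => w; rewrite inE => /orP[/eqP->//|/hp].
  exact: le_trans.
exists p; first by rewrite inE ps orbT.
by move=> w; rewrite inE => /orP[/eqP->|/hp//]; apply: ltW.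
Qed.

Lemma convS (n : nat) (S T : {fset 'rV[int]_n}) x :
  {subset S <= T} -> conv S x -> conv T x.
Proof.
move=> sST [c [c0 c1 ->]].
have E (V : zmodType) (F : 'rV[int]_n -> V) :
    \sum_(u <- S) F u = \sum_(u <- T | u \in S) F u.
  rewrite -[RHS]big_filter; apply: perm_big; apply: uniq_perm => //.
    by rewrite filter_uniq.
  by move=> u; rewrite mem_filter; case: (boolP (u \in S)) => //= /sST ->.
exists (fun u => if u \in S then c u else 0); split.
- by move=> u; case: ifP.
- by rewrite -big_mkcond -E.
rewrite E big_mkcond; apply: eq_bigr => u _; by case: ifP; rewrite ?scale0r.
Qed.

Lemma collinear (n l d : nat) (tau : {fset 'rV[int]_n})
    (pi : 'rV[int]_n -> 'rV[int]_l.+1) :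
  cayley d tau pi -> imprimitive tau pi ->
  exists (i : 'I_l.+1) (e : 'rV[int]_l.+1) p0,
    [/\ e 0 i != 0, p0 \in img tau pi, p0 + e \in img tau pi &
    forall w, w \in img tau pi -> on_line i e (w - p0)].
Proof.
case=> hsim _ [u0 [v0 [ut vt nuv]]] _ himp.
set B := img tau pi.
have hu : pi u0 \in B by apply: in_imfset.
have hv : pi v0 \in B by apply: in_imfset.
pose e := pi v0 - pi u0.
have [i ei] : exists i, e 0 i != 0.
  apply/existsP; apply: contraNT nuv => /existsPn h.
  apply/eqP/rowP => i; have := h i; rewrite negbK !mxE subr_eq0.
  by move/eqP.
exists i, e, (pi u0); split=> //; first by rewrite addrC subrK.
move=> w wB; case: himp => [[dim1 _]|[l1 _]].
  set X := [seq toQ (u - v) | u <- B, v <- B] in dim1.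
  have XB u v : u \in B -> v \in B -> toQ (u - v) \in <<X>>%VS.
    by move=> *; apply: memv_span; apply: allpairs_f.
  have e0 : toQ e != 0.
    apply: contraNneq ei => /rowP/(_ i); rewrite !mxE => /eqP.
    by rewrite intr_eq0.
  have /eqP EX : (<[toQ e]> == <<X>>)%VS.
    rewrite eqEdim dim_vline e0 [\dim _]dim1 andbT.
    by rewrite -memvE; apply: XB.
  have : toQ (w - pi u0) \in <[toQ e]>%VS by rewrite EX; apply: XB.
  move=> /vlineP[t /rowP ht]; apply/rowP => j; rewrite !mulrz_mxE.
  apply: (@intr_inj rat).
  have := ht j; have := ht i; rewrite !mxE !intrM => Ei Ej.
  by rewrite Ei Ej -mulrA mulrCA.
have hB x : x \in B -> \sum_i x 0 i = d%:Z.
  by move=> /imfsetP[u /= hu' ->]; case: (hsim _ hu').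
have sum0 x y : x \in B -> y \in B -> \sum_i (x - y) 0 i = 0.
  move=> hx hy; under eq_bigr do rewrite !mxE.
  by rewrite sumrB !hB // subrr.
have := sum0 _ _ wB hu; have := sum0 _ _ hv hu; rewrite -/e.
move: (w - pi u0) => x {hB sum0}.
move: e ei x; clearbody B; clear -l1; move: i; subst l => i e _ x.
rewrite !big_ord_recl !big_ord0 !addr0 => /eqP; rewrite addr_eq0 => /eqP he.
move=> /eqP; rewrite addr_eq0 => /eqP hx.
have le (y : 'rV[int]_2) j : y 0 j = if j == ord0 then y 0 ord0 else y 0 (lift ord0 ord0).
  by case: eqP => [->//|/eqP nj]; congr (y 0 _); apply/val_inj; case: j nj => [[|[|]]].
rewrite /on_line; apply/rowP => j; rewrite !mulrz_mxE (le e) (le e j) (le x) (le x i).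
rewrite he hx; by case: eqP; case: eqP => *; rewrite ?mulrNN ?mulrN ?mulNr mulrC.
Qed.

Lemma reduction_exists (n l d : nat) (tau : {fset 'rV[int]_n})
    (pi : 'rV[int]_n -> 'rV[int]_l.+1) :
  cayley d tau pi -> imprimitive tau pi ->
  exists (d' : nat) (pi' : 'rV[int]_n -> 'rV[int]_2),
    is_reduction tau pi d' pi'.
Proof.
move=> cay /(collinear cay)[i [e [p0 [ei p0B q0B hl]]]].
move: p0B q0B hl; rewrite /is_reduction; set B := img tau pi => p0B q0B hl.
have [p pB pmin] := seq_min (fun w : 'rV[int]_l.+1 => w 0 i) p0B.
have [q qB qmax] := seq_min (fun w : 'rV[int]_l.+1 => - w 0 i) p0B.
have pq : p 0 i < q 0 i.
  have := pmin _ p0B; have := pmin _ q0B; have := qmax _ p0B; have := qmax _ q0B.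
  rewrite !mxE !lerN2 => h1 h2 h3 h4; rewrite lt_neqAle (le_trans h4 h2) andbT.
  apply: contraNneq ei => E; rewrite E in h3 h4.
  have E1 : p0 0 i = q 0 i by apply/eqP; rewrite eq_le h2.
  have E2 : p0 0 i + e 0 i = q 0 i by apply/eqP; rewrite eq_le h1.
  by apply/eqP/(addrI (p0 0 i)); rewrite E2 addr0.
have hl2 u : u \in B -> on_line i e (u - p).
  move=> uB; have := on_lineD 1 (-1) (hl _ uB) (hl _ pB).
  by rewrite mulr1z mulrN1z opprB addrA subrK.
have [g [c [gpos Eg hg]]] : exists (g : 'rV[int]_l.+1) (c : 'rV[int]_l.+1 -> int),
    [/\ 0 < g 0 i, g = \sum_(u <- B) (u - p) *~ c u &
        forall u, u \in B -> exists k : int, u - p = g *~ k].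
  have [g [c [Eg og hg]]] := line_generator (D := fun u => u - p) ei (fset_uniq B) hl2.
  have g0 : g 0 i != 0.
    have [k /rowP/(_ i)] := hg _ qB; rewrite !mulrz_mxE !mxE.
    apply: contra_eq_neq => ->; rewrite mul0r subr_eq0.
    by rewrite gt_eqF.
  case: (ltrgtP (g 0 i) 0) g0 => // hgi _; last by exists g, c.
  exists (- g), (fun u => - c u); split.
  - by rewrite mxE oppr_gt0.
  - by rewrite Eg -sumrN; apply: eq_bigr => u _; rewrite mulrNz.
  - by move=> u /hg[k ->]; exists (- k); rewrite mulNrz mulrNz opprK.
pose kap (u : 'rV[int]_l.+1) := ((u ord0 i - p ord0 i) %/ g ord0 i)%Z.
have g0 : g 0 i != 0 by rewrite gt_eqF.
have hk u : u \in B -> u - p = g *~ kap u.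
  move=> /hg[k Ek]; rewrite Ek; congr (_ *~ _).
  have /rowP/(_ i) := Ek; rewrite mulrz_mxE !mxE /kap => ->.
  by rewrite mulrC mulzK.
have hki u : u \in B -> u 0 i - p 0 i = g 0 i * kap u.
  by move=> /hk/rowP/(_ i); rewrite mulrz_mxE !mxE.
have kap0 u : u \in B -> 0 <= kap u.
  move=> uB; rewrite -(pmulr_rge0 _ gpos) -hki // subr_ge0; exact: pmin.
have kapq u : u \in B -> kap u <= kap q.
  move=> uB; rewrite -(ler_pM2l gpos) -!hki // lerD2r -lerN2; exact: qmax.
have [d' Ed'] : exists d' : nat, kap q = d'%:Z.
  by exists `|kap q|%N; rewrite gez0_abs ?kap0.
have d0 : d' != 0%N.
  apply: contraTneq pq => E; have := hki _ qB; rewrite Ed' E mulr0.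
  by move=> /eqP; rewrite subr_eq0 => /eqP->; rewrite ltxx.
pose rho (w : 'rV[int]_l.+1) : 'rV[int]_2 :=
  \row_j if j == 0 then d'%:Z - kap w else kap w.
have kp : kap p = 0 by rewrite /kap subrr div0z.
exists d', (rho \o pi), p, q, rho; split=> //; first split=> //.
- move=> x; split; last first.
    by apply: convS => u; rewrite !inE => /orP[]/eqP->.
  case=> a [a0 a1 ->].
  pose t u : rat := (kap u)%:~R / d'%:R.
  have t0 u : u \in B -> 0 <= t u by move=> uB; rewrite divr_ge0 ?ler0z ?kap0.
  have t1 u : u \in B -> t u <= 1.
    move=> uB; rewrite ler_pdivrMr ?ltr0n ?lt0n // mul1r.
    by rewrite -[d'%:R]/(d'%:Z%:~R) ler_int -Ed' kapq.
  have npq : p != q by apply: contraTneq pq => ->; rewrite ltxx.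
  pose S := \sum_(u <- B) a u * t u.
  have S0 : 0 <= S by rewrite /S big_seq sumr_ge0 // => u uB; rewrite mulr_ge0 ?a0 ?t0.
  have S1 : S <= 1.
    rewrite -a1 /S !big_seq; apply: ler_sum => u uB.
    by rewrite ler_piMr ?a0 ?t1.
  have E2 (V : zmodType) (F : 'rV[int]_l.+1 -> V) :
      \sum_(u <- [fset p; q]) F u = F p + F q.
    by rewrite big_fsetU1 ?inE ?(negPf npq) //= big_seq_fset1.
  exists (fun u => if u == q then S else 1 - S); split.
  + by move=> u; case: ifP; rewrite ?subr_ge0.
  + by rewrite E2 (negPf npq) eqxx subrK.
  rewrite E2 (negPf npq) eqxx.
  have Et u : u \in B -> toQ u = toQ p + t u *: (toQ q - toQ p).
    move=> uB; apply/rowP => j.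
    have /rowP/(_ j) := hk _ uB; have /rowP/(_ j) := hk _ qB.
    rewrite !mulrz_mxE !mxE Ed' => Eq Eu.
    rewrite -intrB Eq -[u 0 j](subrK (p 0 j)) Eu intrD [RHS]addrC; congr (_ + _).
    by rewrite /t !intrM mulrCA divfK ?pnatr_eq0.
  rewrite big_seq; under eq_bigr => u uB do rewrite (Et u uB) scalerDr scalerA.
  rewrite -big_seq big_split /= -!scaler_suml a1 scale1r -/S.
  by rewrite scalerBl scalerBr scale1r addrA addrAC.
- exists g; split; last by rewrite hk // Ed'.
  move=> w; split=> [[a ->]|[k ->]].
    rewrite big_seq; elim/big_ind: _ => [|x y [k ->] [k' ->]|u uB].
    - by exists 0; rewrite mulr0z.
    - by exists (k + k'); rewrite mulrzDr.
    rewrite big_seq; elim/big_ind: _ => [|x y [k ->] [k' ->]|v vB].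
    - by exists 0; rewrite mulr0z.
    - by exists (k + k'); rewrite mulrzDr.
    exists ((kap u - kap v) * a u v).
    by rewrite mulrzA mulrzBr -!hk // opprB addrA subrK.
  exists (fun u v => if v == p then c u * k else 0).
  rewrite Eg mulrz_suml; apply: eq_bigr => u _.
  rewrite (bigD1_seq p) ?fset_uniq //= eqxx big1 ?addr0 ?mulrzA //.
  by move=> v /negPf ->; rewrite mulr0z.
- split.
  + pose L : 'M[rat]_(l.+1, 2) := \matrix_(a, j)
      if a == i then (if j == 0 then -1 else 1) / (g 0 i)%:~R else 0.
    pose b : 'rV[rat]_2 := \row_j
      if j == 0 then d'%:R + (p 0 i)%:~R / (g 0 i)%:~R
      else - ((p 0 i)%:~R / (g 0 i)%:~R).
    exists L, b.
    move=> u uB; apply/rowP => j; rewrite !mxE (bigD1 i) //=.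
    rewrite [X in _ + X + _]big1 => [|a /negPf na]; last first.
      by rewrite !mxE na mulr0.
    rewrite addr0.
    rewrite !mxE eqxx.
    have Ek : (kap u)%:~R = ((u 0 i)%:~R - (p 0 i)%:~R) / (g 0 i)%:~R :> rat.
      by rewrite -intrB hki // intrM mulrC mulKf ?intr_eq0.
    case: ifP => _; last by rewrite Ek mul1r mulrBl.
    by rewrite intrB Ek mulrBl opprB mulN1r mulrN addrA [RHS]addrC.
  + move=> u v uB vB /rowP/(_ 1); rewrite !mxE /= => Ek.
    by apply: (addIr (- p)); rewrite !hk // Ek.
  + move=> w wB; split=> [j|].
      by rewrite mxE; case: ifP => _; rewrite ?subr_ge0 -?Ed' ?kapq ?kap0.
    by rewrite !big_ord_recl big_ord0 !mxE /= addr0 subrK.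
- by apply/rowP => j; rewrite !mxE kp subr0; case: (j == 0); rewrite ?mulr1 ?mulr0.
- apply/rowP => j; rewrite !mxE Ed' subrr.
  by case: j => [[|[|]]] //= ?; rewrite ?mulr1 ?mulr0.
Qed.

(* Main.v *)
Require Import Defs.
From mathcomp Require Import all_boot all_order all_algebra all_field.
From mathcomp Require Import finmap.
From mathcomp Require Import mpoly.
From mathcomp Require Import ring zify.

Set Implicit Arguments.
Unset Strict Implicit.
Unset Printing Implicit Defensive.

Import Order.TTheory GRing.Theory Num.Theory.
Local Open Scope fset_scope.
Local Open Scope ring_scope.

(** Write [f^v] for the product of the [f_i^(v_i)]. The curve of [pi] and [f] is
    the closure of the image of the map [phi : y |-> (f^(pi u) (y))_u] from the
    projective line. When the forms have distinct roots, [phi] is given by forms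
    of degree [d] without common zero.

    Degree of a generically injective parametrization. A general hyperplane
    pulls back to a binary form of degree [d]. In characteristic zero this form
    has [d] distinct roots ([separable_member]: a Wronskian has finitely many
    zeros), and they avoid the finitely many points where [phi] fails to be
    injective. The image is closed ([param_image_closed], by a determinant built
    from Bezout identities), so the curve has exactly [d] points on the
    hyperplane ([degree_param]). Everything thus depends on whether [phi] is
    generically injective.

    Suppose [phi z = phi y]. Then the torus element [t_k = f_k(z) / f_k(y)] is
    killed by every character in the difference lattice of the image of [pi]
    ([same_image_chi]). If [l = 1] and the differences have greatest common
    divisor one, this forces [t_0 = t_1], hence [z = y] as projective points
    ([length_one_injective]). If the lattice has rank at least two, two
    independent characters impose two conditions, and since [z] moves in a
    single parameter they have no common solution [z <> y] for general [f]. To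
    make this precise, [y] is first fixed at [1 : 0] and put at infinity; the
    conditions become two polynomials in one variable [s], with coefficients
    polynomial in [f], and their resultant is a nonzero polynomial because it is
    nonzero for suitable special forms ([coprime_parameters],
    [generic_injective_at_origin]). A shear of the line then replaces [1 : 0] by
    almost any other point ([injective_from_origin]).

    If [pi] is imprimitive, its image lies on a segment from [p] to
    [q = p + d' g], where [g] generates the difference lattice. The points [p]
    and [q] are [d'] times the negative part [g^-] and the positive part [g^+]
    of [g] ([reduction_coordinates]). Therefore
    [phi(y) = (P(y)^(d' - k_u) Q(y)^(k_u))_u], where [P] and [Q] are the products
    of the forms with exponents [g^-] and [g^+]. The map [y |-> (P(y), Q(y))] is
    onto, so this curve is the curve of the reduction ([imprimitive_curve]),
    which is primitive of length one and hence of degree [d'] by the above. As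
    [d' < d] ([imprimitive_degree_lt]) and the degree of a curve is well defined
    ([curve_degree_unique]), degree [d] characterizes primitivity. *)

(** * Generic points *)

Lemma exists_nonroot (K : closedFieldType) (p : {poly K}) :
  p != 0 -> exists t, p.[t] != 0.
Proof. by move=> /closed_nonrootP[t]; exists t. Qed.

Lemma prod_neq0 (R : idomainType) (I : eqType) (s : seq I) (F : I -> R) :
  (forall i, i \in s -> F i != 0) -> \prod_(i <- s) F i != 0.
Proof. by move=> h; rewrite prodf_seq_neq0; apply/allP => i /h. Qed.

Lemma prod_neq0P (R : idomainType) (I : eqType) (s : seq I) (F : I -> R) :
  \prod_(i <- s) F i != 0 -> forall i, i \in s -> F i != 0.
Proof. by rewrite prodf_seq_neq0 => /allP. Qed.

Lemma base_expansion_inj (B n : nat) (a b : 'I_n -> nat) :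
  (forall i, a i < B)%N -> (forall i, b i < B)%N ->
  (\sum_i a i * B ^ i = \sum_i b i * B ^ i)%N -> a =1 b.
Proof.
elim: n a b => [|n IH] a b ha hb; first by move=> _ [].
have shift (c : 'I_n.+1 -> nat) :
    (\sum_i c i * B ^ i = (\sum_(i < n) c (lift ord0 i) * B ^ i) * B + c ord0)%N.
  rewrite big_ord_recl expn0 muln1 addnC big_distrl /=; congr addn.
  by apply: eq_bigr => i _; rewrite /bump /= add1n expnSr mulnA.
rewrite !shift => E.
have E0 : a ord0 = b ord0.
  by have := congr1 (modn^~ B) E; rewrite /= !modnMDl !modn_small.
have B0 : (0 < B)%N by apply: leq_ltn_trans (ha ord0).
move/eqP: E; rewrite E0 eqn_add2r eqn_pmul2r // => /eqP E i.
case: (unliftP ord0 i) => [j ->|->] //.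
exact: (IH (fun j => a (lift ord0 j)) (fun j => b (lift ord0 j))).
Qed.

(** Kronecker's substitution ['X_i := t ^ (B ^ i)], with [B] larger than all
    exponents, sends distinct monomials to distinct powers of [t]; it reduces
    the statement to one variable. *)
Lemma mpoly_nonzero_value (K : closedFieldType) (N : nat) (G : {mpoly K[N]}) :
  G != 0 -> exists v : 'rV[K]_N, G.@[v 0] != 0.
Proof.
move=> G0; pose B := (msize G).+1.
pose code (m : 'X_{1..N}) := (\sum_i m i * B ^ i)%N.
pose q : {poly K} := \sum_(m <- msupp G) G@_m *: 'X^(code m).
have hB m i : m \in msupp G -> (m i < B)%N.
  move=> /msize_mdeg_lt h; apply: leq_ltn_trans (leqW h); rewrite mdegE.
  by rewrite (bigD1 i) //= leq_addr.
have [m0 hm0] : exists m, m \in msupp G.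
  case E: (msupp G) => [|m s]; last by exists m; rewrite inE eqxx.
  by move/eqP: E; rewrite msupp_eq0 (negPf G0).
have q0 : q != 0.
  apply: contraTneq hm0 => /(congr1 (fun p : {poly K} => p`_(code m0))).
  rewrite coef0 /q coef_sum => E; apply/negP => hm0.
  move: E; rewrite (bigD1_seq m0) ?msupp_uniq //= coefZ coefXn eqxx mulr1.
  rewrite big_seq_cond big1 ?addr0 => [/eqP|m /andP[hm nm]].
    by apply/negP; rewrite -mcoeff_msupp.
  rewrite coefZ coefXn; case: eqP => [E|_]; last by rewrite mulr0.
  case/eqP: nm; apply/mnmP; apply: (@base_expansion_inj B _ _ _ _ _ (esym E)).
    by move=> i; apply: hB.
  by move=> i; apply: hB.
have [t ht] := exists_nonroot q0.
exists (\row_i t ^+ (B ^ i)); apply: contraNneq ht => <-.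
rewrite mevalE /q horner_sum; apply/eqP; apply: eq_bigr => m _.
rewrite hornerZ hornerXn; congr (_ * _).
rewrite /code -prodrXr; apply: eq_bigr => i _.
by rewrite mxE -exprM mulnC.
Qed.

Lemma generic_imp (K : fieldType) (N : nat) (P Q : 'rV[K]_N -> Prop) :
  (forall v, P v -> Q v) -> generic P -> generic Q.
Proof. by move=> PQ [G G0 hG]; exists G => // v /hG/PQ. Qed.

Lemma generic_and (K : fieldType) (N : nat) (P Q : 'rV[K]_N -> Prop) :
  generic P -> generic Q -> generic (fun v => P v /\ Q v).
Proof.
move=> [G G0 hG] [H H0 hH]; exists (G * H); first by rewrite mulf_neq0.
by move=> v; rewrite mevalM mulf_eq0 negb_or => /andP[/hG ? /hH].
Qed.

Lemma generic_exists (K : closedFieldType) (N : nat) (P : 'rV[K]_N -> Prop) :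
  generic P -> exists v, P v.
Proof.
by move=> [G /mpoly_nonzero_value[v hv] hG]; exists v; apply: hG.
Qed.

Lemma generic_value (K : fieldType) (N : nat) (G : {mpoly K[N]})
    (w : 'rV[K]_N) :
  G.@[w 0] != 0 -> generic (fun v : 'rV[K]_N => G.@[v 0] != 0).
Proof.
by move=> hw; exists G => //; apply: contraNneq hw => ->; rewrite meval0.
Qed.

Lemma generic_all (K : fieldType) (N : nat) (I : eqType) (s : seq I)
    (P : I -> 'rV[K]_N -> Prop) :
  (forall i, i \in s -> generic (P i)) ->
  generic (fun v => forall i, i \in s -> P i v).
Proof.
elim: s => [_|a s IH h]; first by exists 1; rewrite ?oner_neq0.
apply: generic_imp (generic_and (h a _) (IH _)); last 2 first.
- by rewrite inE eqxx.
- by move=> i hi; apply: h; rewrite inE hi orbT.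
by move=> v [Pa Ps] i; rewrite inE => /orP[/eqP->|/Ps].
Qed.

Lemma map_resultant_rmorph (R S : nzRingType) (f : {rmorphism R -> S})
    (p q : {poly R}) :
  f (lead_coef p) != 0 -> f (lead_coef q) != 0 ->
  f (resultant p q) = resultant (map_poly f p) (map_poly f q).
Proof.
move=> fp fq; rewrite /resultant /Sylvester_mx !size_map_poly_id0 //.
rewrite -det_map_mx /= map_col_mx; congr (\det (col_mx _ _));
  by apply: map_lin1_mx => v; rewrite map_poly_rV rmorphM /= map_rVpoly.
Qed.

(** Coprimality of two polynomials whose coefficients depend on parameters is
    an open condition as long as both leading coefficients survive: the
    resultant detects it, and it commutes with specialization there. *)
Lemma generic_no_common_root (K : closedFieldType) (N : nat)
    (P Q : {poly {mpoly K[N]}}) (w : 'rV[K]_N) :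
  let spec (v : 'rV[K]_N) := map_poly (meval (v 0)) in
  (lead_coef P).@[w 0] != 0 -> (lead_coef Q).@[w 0] != 0 ->
  (forall t, root (spec w P) t -> ~~ root (spec w Q) t) ->
  generic (fun v => forall t, root (spec v P) t -> ~~ root (spec v Q) t).
Proof.
move=> spec lP lQ cop.
pose G := resultant P Q * (lead_coef P * lead_coef Q).
have : G.@[w 0] != 0.
  rewrite /G !mevalM !mulf_neq0 // map_resultant_rmorph // resultant_eq0 -leqNgt.
  have -> : (size (gcdp (spec w P) (spec w Q)) <= 1)%N
      = coprimep (spec w P) (spec w Q).
    have : gcdp (spec w P) (spec w Q) != 0.
      apply: contraNneq lP => /eqP; rewrite gcdp_eq0 => /andP[/eqP E _].
      have := congr1 (fun p : {poly K} => p`_(size P).-1) E.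
      by rewrite coef_map coef0 /lead_coef /= => ->.
    by rewrite -size_poly_gt0 coprimep_def; case: size => [|[|]].
  by apply/Pdiv.ClosedField.coprimepP => t /cop.
move/generic_value; apply: generic_imp => v; rewrite !mevalM !mulf_eq0 !negb_or.
case/and3P=> hres vP vQ t.
have small (F : {poly {mpoly K[N]}}) :
    (lead_coef F).@[v 0] != 0 -> (size F <= 1)%N -> ~~ root (spec v F) t.
  move=> lF /size1_polyC E; move: lF; rewrite E lead_coefC /spec map_polyC /=.
  by rewrite rootC.
case: (leqP (size P) 1) => [/(small _ vP)/negPf-> //|sP].
case: (leqP (size Q) 1) => [/(small _ vQ)/negPf-> //|sQ].
have [[U V] /= _ E] := resultant_in_ideal sP sQ.
move=> /rootP rP; apply: contra hres => /rootP rQ.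
have := congr1 (fun F => (spec v F).[t]) E.
rewrite /spec /= map_polyC /= hornerC rmorphD !rmorphM /= hornerD !hornerM.
by rewrite rP rQ !mulr0 addr0 => ->.
Qed.

(** * Binary forms *)

Definition pt (T : Type) (a b : T) : 'rV[T]_2 :=
  \row_j (if j == 0 then a else b).

Lemma pt0 (T : Type) (a b : T) : pt a b 0 0 = a. Proof. by rewrite mxE. Qed.
Lemma pt1 (T : Type) (a b : T) : pt a b 0 1 = b. Proof. by rewrite mxE. Qed.

Lemma ptE (T : Type) (y : 'rV[T]_2) : y = pt (y 0 0) (y 0 1).
Proof.
apply/rowP => j; rewrite mxE; case: eqP => [->//|/eqP j0]; congr (y 0 _).
by case: j j0 => [[|[|]]] // ? _; apply/val_inj.
Qed.

Lemma pt_neq0 (K : fieldType) (a b : K) : (pt a b != 0) = (a != 0) || (b != 0).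
Proof.
rewrite -negb_and; congr negb; apply/eqP/andP => [/rowP E|[/eqP-> /eqP->]].
  by have := E 0; have := E 1; rewrite !mxE /= => -> ->; rewrite !eqxx.
by apply/rowP => j; rewrite !mxE if_same.
Qed.

(** The form of degree [d] whose dehomogenization at [y_0 = 1] is [p]; the
    coefficient of ['X^d] in [p] is its value at infinity. *)
Definition hform (K : fieldType) (d : nat) (p : {poly K}) (y : 'rV[K]_2) : K :=
  \sum_(i < d.+1) p`_i * (y 0 0 ^+ (d - i) * y 0 1 ^+ i).

Lemma hform_affine (K : fieldType) d (p : {poly K}) t :
  (size p <= d.+1)%N -> hform d p (pt 1 t) = p.[t].
Proof.
move=> sp; rewrite (horner_coef_wide _ sp); apply: eq_bigr => i _.
by rewrite pt0 pt1 expr1n mul1r.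
Qed.

Lemma hform_infty (K : fieldType) d (p : {poly K}) : hform d p (pt 0 1) = p`_d.
Proof.
rewrite /hform big_ord_recr /= big1 => [|i _].
  by rewrite pt0 pt1 subnn expr1n !mulr1 add0r.
by rewrite pt0 expr0n subn_eq0 leqNgt ltn_ord /= mul0r mulr0.
Qed.

Lemma hformZ (K : fieldType) d (p : {poly K}) (c : K) y :
  hform d p (c *: y) = c ^+ d * hform d p y.
Proof.
rewrite /hform mulr_sumr; apply: eq_bigr => i _.
rewrite !mxE !exprMn mulrACA -exprD subnK; last by rewrite -ltnS.
exact: mulrCA.
Qed.

Lemma pt_cases (K : fieldType) (y : 'rV[K]_2) : y != 0 ->
  (exists c t, c != 0 /\ y = c *: pt 1 t) \/
  (exists2 c, c != 0 & y = c *: pt 0 1).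
Proof.
move=> y0; case: (eqVneq (y 0 0) 0) => [E|a0]; [right|left].
  exists (y 0 1); first by move: y0; rewrite {1}[y]ptE pt_neq0 E eqxx.
  by apply/rowP => j; rewrite [y]ptE !mxE E /=; case: ifP; rewrite ?mulr0 ?mulr1.
exists (y 0 0), (y 0 1 / y 0 0); split=> //; apply/rowP => j.
by rewrite [y]ptE !mxE /=; case: ifP; rewrite ?mulr1 // mulrC divfK.
Qed.

Lemma hformM (K : fieldType) d e (p q : {poly K}) y :
  (size p <= d.+1)%N -> (size q <= e.+1)%N ->
  hform (d + e) (p * q) y = hform d p y * hform e q y.
Proof.
move=> sp sq; have [->|] := eqVneq y 0.
  have h0 k (f : {poly K}) : hform k f 0 = f`_0 * 0 ^+ k.
    rewrite /hform big_ord_recl big1 => [|i _].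
      by rewrite !mxE subn0 expr0 mulr1 addr0.
    by rewrite !mxE [0 ^+ bump 0 i]expr0n /= !mulr0.
  by rewrite !h0 coef0M exprD mulrACA.
case/pt_cases=> [[c [t [_ ->]]]|[c _ ->]]; rewrite !hformZ exprD mulrACA.
  rewrite !hform_affine ?hornerM //.
  by apply: leq_trans (size_polyMleq _ _) _; rewrite -subn1 leq_subLR add1n -addSn -addnS leq_add.
congr (_ * _); rewrite !hform_infty coefM.
have hd : (d < (d + e).+1)%N by rewrite ltnS leq_addr.
rewrite (bigD1 (Ordinal hd)) //= addKn big1 ?addr0 // => i ni.
case: (ltngtP i d) => [lid|ldi|/eqP E]; last by rewrite -val_eqE /= E in ni.
  rewrite [q`__]nth_default ?mulr0 //; apply: leq_trans sq _.
  by rewrite ltn_subRL ltn_add2r.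
by rewrite [p`__]nth_default ?mul0r //; apply: leq_trans sp _.
Qed.

Lemma hform1 (K : fieldType) y : hform 0 1 y = 1 :> K.
Proof. by rewrite /hform big_ord1 coef1 expr0 !mulr1. Qed.

Lemma hform_sum (K : fieldType) d (I : finType) (a : I -> K)
    (p : I -> {poly K}) y :
  hform d (\sum_i a i *: p i) y = \sum_i a i * hform d (p i) y.
Proof.
rewrite /hform; under eq_bigr => i _ do rewrite coef_sum mulr_suml.
rewrite exchange_big /=; apply: eq_bigr => k _; rewrite mulr_sumr.
by apply: eq_bigr => i _; rewrite coefZ -mulrA.
Qed.

(** * Linear forms on the ambient space *)

Definition dot (K : fieldType) (N : nat) (a x : 'rV[K]_N) : K :=
  \sum_i a 0 i * x 0 i.

Lemma dotDZl (K : fieldType) (N : nat) (a b x : 'rV[K]_N) s :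
  dot (a + s *: b) x = dot a x + s * dot b x.
Proof.
by rewrite /dot mulr_sumr -big_split; apply: eq_bigr => i _; rewrite !mxE mulrDl mulrA.
Qed.

Lemma dotZr (K : fieldType) (N : nat) (a x : 'rV[K]_N) c :
  dot a (c *: x) = c * dot a x.
Proof. by rewrite /dot mulr_sumr; apply: eq_bigr => i _; rewrite mxE mulrCA. Qed.

Lemma dot_delta (K : fieldType) (N : nat) (x : 'rV[K]_N) k :
  dot (delta_mx 0 k) x = x 0 k.
Proof.
rewrite /dot (bigD1 k) //= big1 => [|i ik]; rewrite mxE eqxx ?eqxx ?mul1r ?addr0 //.
by rewrite (negPf ik) mul0r.
Qed.

Lemma separating_form (K : fieldType) (N : nat) (x v : 'rV[K]_N) :
  x != 0 ->
  (exists c, v = c *: x) \/ (exists a, dot a x = 0 /\ dot a v != 0).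
Proof.
move=> x0.
have /existsP[k xk] : [exists k, x 0 k != 0].
  apply: contraNT x0 => /existsPn h; apply/eqP/rowP => k; rewrite mxE.
  by have := h k; rewrite negbK => /eqP.
have [/existsP[j vj]|/existsPn h] := boolP [exists j, v 0 j != v 0 k / x 0 k * x 0 j];
  [right | left]; last first.
  exists (v 0 k / x 0 k); apply/rowP => j.
  by rewrite mxE; have := h j; rewrite negbK => /eqP.
exists (x 0 k *: delta_mx 0 j + (- x 0 j) *: delta_mx 0 k).
have E (w : 'rV[K]_N) : dot (x 0 k *: delta_mx 0 j + (- x 0 j) *: delta_mx 0 k) w
    = x 0 k * w 0 j - x 0 j * w 0 k.
  rewrite dotDZl dot_delta mulNr; congr (_ - _).
  rewrite -[x 0 k *: _]add0r dotDZl dot_delta /dot big1 ?add0r // => i _.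
  by rewrite mxE mul0r.
rewrite !E; split; first by rewrite mulrC subrr.
rewrite subr_eq0; apply: contraNneq vj => h.
by rewrite mulrAC [v 0 k * _]mulrC -h mulrC mulKf.
Qed.

Lemma nonvanishing_form (K : fieldType) (N : nat) (v : 'rV[K]_N) :
  v != 0 -> exists a, dot a v != 0.
Proof.
move=> v0; suff /existsP[k] : [exists k, v 0 k != 0].
  by exists (delta_mx 0 k); rewrite dot_delta.
apply: contraNT v0 => /existsPn h; apply/eqP/rowP => k; rewrite mxE.
by have := h k; rewrite negbK => /eqP.
Qed.

(** The linear forms vanishing at [x] are not a union of finitely many proper
    subspaces, the field being infinite. *)
Lemma simultaneous_form (K : closedFieldType) (N : nat) (x : 'rV[K]_N)
    (s : seq 'rV[K]_N) :
  (forall v, v \in s -> exists a, dot a x = 0 /\ dot a v != 0) ->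
  exists a, dot a x = 0 /\ forall v, v \in s -> dot a v != 0.
Proof.
elim: s => [_|w s IH h].
  by exists 0; split=> //; rewrite /dot big1 // => i _; rewrite mxE mul0r.
have [|b [bx bs]] := IH; first by move=> v vs; apply: h; rewrite inE vs orbT.
have [|a [ax aw]] := h w; first by rewrite inE eqxx.
pose p v : {poly K} := (dot b v)%:P + dot a v *: 'X.
have pE v t : (p v).[t] = dot (b + t *: a) v.
  by rewrite /p hornerD hornerC hornerZ hornerX dotDZl mulrC.
have [|t] := @exists_nonroot K (\prod_(v <- w :: s) p v).
  apply: prod_neq0 => v; rewrite inE => /orP[/eqP->|vs].
    apply: contraNneq aw => /(congr1 (fun p : {poly K} => p`_1)).
    by rewrite coefD coefC coefZ coefX coef0 add0r mulr1 => ->.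
  apply: contraNneq (bs _ vs) => /(congr1 (fun p : {poly K} => p`_0)).
  by rewrite coefD coefC coefZ coefX coef0 mulr0 addr0 => ->.
rewrite horner_prod => /prod_neq0P ht; exists (b + t *: a).
by split=> [|v /ht]; rewrite -?pE // pE dotDZl bx ax mulr0 addr0.
Qed.

(** * Parametrized curves *)

Lemma closed_root_seq (K : closedFieldType) (g : {poly K}) :
  g != 0 -> exists s : seq K, forall t, root g t = (t \in s).
Proof.
move=> g0; have [s E] := closed_field_poly_normal g.
by exists s => t; rewrite E rootZ ?root_prod_XsubC // lead_coef_eq0.
Qed.

(** The affine equation of the divisor cut out by the hyperplane [a]. *)
Definition lin (K : fieldType) (N : nat) (p : 'I_N -> {poly K}) (a : 'rV[K]_N) :
  {poly K} := \sum_k a 0 k *: p k.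

Definition bmap (K : fieldType) (d N : nat) (p : 'I_N -> {poly K})
    (y : 'rV[K]_2) : 'rV[K]_N :=
  \row_k hform d (p k) y.

Definition param_image (K : fieldType) (d N : nat) (p : 'I_N -> {poly K})
    (x : 'rV[K]_N) : Prop :=
  x != 0 /\ exists2 y : 'rV[K]_2, y != 0 & x = bmap d p y.

Definition basepoint_free (K : fieldType) (d N : nat) (p : 'I_N -> {poly K}) :=
  forall y : 'rV[K]_2, y != 0 -> bmap d p y != 0.

(** The point at infinity counts among the finitely many excluded points, so
    that the exceptional set is given by a polynomial. *)
Definition generically_injective (K : fieldType) (N : nat)
    (phi : 'rV[K]_2 -> 'rV[K]_N) : Prop :=
  exists2 g : {poly K}, g != 0 &
    forall t z, g.[t] != 0 -> z != 0 ->
      same_point (phi z) (phi (pt 1 t)) -> same_point z (pt 1 t).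

Lemma dot_bmap (K : fieldType) (d N : nat) (p : 'I_N -> {poly K}) a y :
  dot a (bmap d p y) = hform d (lin p a) y.
Proof. by rewrite hform_sum; apply: eq_bigr => k _; rewrite mxE. Qed.

Lemma bmapZ (K : fieldType) (d N : nat) (p : 'I_N -> {poly K}) c y :
  bmap d p (c *: y) = c ^+ d *: bmap d p y.
Proof. by apply/rowP => k; rewrite !mxE hformZ. Qed.

Lemma size_lin (K : fieldType) (d N : nat) (p : 'I_N -> {poly K}) a :
  (forall k, size (p k) <= d.+1)%N -> (size (lin p a) <= d.+1)%N.
Proof.
move=> sp; apply: leq_trans (size_sum _ _ _) _; apply/bigmax_leqP => k _.
exact: leq_trans (size_scale_leq _ _) (sp k).
Qed.

(** Reducing the second Bezout cofactor modulo [p] bounds its degree; the bound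
    on the first one follows by comparing degrees. *)
Lemma bezout_size (K : fieldType) (d : nat) (p q h : {poly K}) :
  coprimep p q -> size p = d.+2 -> (size q <= d.+2)%N ->
  (size h <= d.+1 + d.+1)%N ->
  exists u v : {poly K}, [/\ (size u <= d.+1)%N, (size v <= d.+1)%N & h = u * p + v * q].
Proof.
move=> /Bezout_eq1_coprimepP[[u v] /= E] sp sq sh.
have p0 : p != 0 by rewrite -size_poly_eq0 sp.
pose v' : {poly K} := (h * v) %% p; pose u' : {poly K} := h * u + (h * v) %/ p * q.
have Eh : h = u' * p + v' * q.
  rewrite -[LHS]mulr1 -E mulrDr !mulrA (divp_eq (h * v) p) /u' -/v'.
  by ring.
have sv : (size v' <= d.+1)%N by rewrite -ltnS -sp ltn_modp.
exists u', v'; split=> //.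
have [->|u0] := eqVneq u' 0; first by rewrite size_poly0.
have : (size (u' * p)%R <= d.+1 + d.+1)%N.
  have -> : u' * p = h - v' * q by rewrite Eh addrK.
  apply: leq_trans (size_polyD _ _) _; rewrite geq_max sh size_polyN /=.
  apply: leq_trans (size_polyMleq _ _) _.
  by rewrite -subn1 leq_subLR add1n -addnS leq_add.
by rewrite size_mul // sp addnS /= leq_add2r.
Qed.

Lemma dhomog_prod_ord (K : fieldType) (N d : nat) (F : 'I_d -> {mpoly K[N]}) :
  (forall i, F i \is 1.-homog) -> \prod_i F i \is d.-homog.
Proof.
elim: d F => [|d IH] F hF; first by rewrite big_ord0 dhomog1.
rewrite big_ord_recl; apply: (@dhomogM _ _ _ 1) => //; exact: IH.
Qed.

Lemma det_dhomog (K : fieldType) (N d : nat) (M : 'M[{mpoly K[N]}]_d) :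
  (forall i j, M i j \is 1.-homog) -> \det M \is d.-homog.
Proof.
move=> hM; rewrite /determinant rpred_sum // => s _.
by rewrite rpredMsign; apply: dhomog_prod_ord => i.
Qed.

Definition mlin (K : fieldType) (N : nat) (a : 'rV[K]_N) : {mpoly K[N]} :=
  \sum_k a 0 k *: 'X_k.

Lemma meval_mlin (K : fieldType) (N : nat) (a x : 'rV[K]_N) :
  (mlin a).@[x 0] = dot a x.
Proof.
rewrite /mlin raddf_sum; apply: eq_bigr => k _.
by rewrite /= mevalZ mevalXU.
Qed.

Lemma mlin_homog (K : fieldType) (N : nat) (a : 'rV[K]_N) :
  mlin a \is 1.-homog.
Proof.
by rewrite rpred_sum // => k _; rewrite rpredZ // dhomogX /= mdeg1.
Qed.

(** If [x] is not in the image, two linear forms [a1], [a2] vanishing at [x]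
    pull back to coprime binary forms [p1], [p2]; let [a0] not vanish at [x] and
    pull back to [p0]. By coprimality, [p0] times a form of degree [d - 1] is a
    combination of [p1] and [p2] with forms of degree [d - 1] as coefficients:
    [p0 * b_j = \sum_k (U_kj p1 + V_kj p2) * b_k] on the monomial basis [b].
    The determinant of [a0 - a1 U - a2 V] vanishes on the image, where [b] is a
    kernel vector, but equals [a0(x) ^ d] at [x]. *)
Lemma param_image_closed (K : closedFieldType) (d N : nat)
    (p : 'I_N -> {poly K}) (x : 'rV[K]_N) :
  (0 < d)%N -> (forall k, size (p k) <= d.+1)%N -> basepoint_free d p ->
  zariski_closure (param_image d p) x ->
  exists2 y, y != 0 & same_point x (bmap d p y).
Proof.
case: d => // d _ sp bpf [x0 hx].
have prop y : y != 0 -> (exists c, bmap d.+1 p y = c *: x) ->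
    exists2 y, y != 0 & same_point x (bmap d.+1 p y).
  move=> y0 [c E]; exists y => //; exists c^-1.
    by rewrite invr_eq0; apply: contraNneq (bpf y y0) => c0; rewrite E c0 scale0r.
  rewrite E scalerA mulVf ?scale1r //.
  by apply: contraNneq (bpf y y0) => c0; rewrite E c0 scale0r.
have inf0 : pt 0 1 != 0 :> 'rV[K]_2 by rewrite pt_neq0 oner_eq0 orbT.
have aff0 t : pt 1 t != 0 :> 'rV[K]_2 by rewrite pt_neq0 oner_eq0.
have [/(prop _ inf0)//|[a1 [a1x]]] := separating_form (bmap d.+1 p (pt 0 1)) x0.
rewrite dot_bmap hform_infty; set p1 := lin p a1 => lead1.
have s1 : size p1 = d.+2.
  apply/eqP; rewrite eqn_leq size_lin //= ltnNge.
  by apply: contra lead1 => /leq_sizeP->.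
have [s hs] : exists s : seq K, forall t, root p1 t = (t \in s).
  by apply: closed_root_seq; rewrite -size_poly_eq0 s1.
have [[y y0 hy]|sep] : (exists2 y, y != 0 & same_point x (bmap d.+1 p y)) \/
    forall t, t \in s -> exists a, dot a x = 0 /\ dot a (bmap d.+1 p (pt 1 t)) != 0.
- elim: s {hs} => [|t s [IH|IH]]; [by right | by left |].
  have [/(prop _ (aff0 t))|h] := separating_form (bmap d.+1 p (pt 1 t)) x0.
    by left.
  by right=> t'; rewrite inE => /orP[/eqP->|/IH].
- by exists y.
have [|a2 [a2x h2]] := @simultaneous_form _ _ x [seq bmap d.+1 p (pt 1 t) | t <- s].
  by move=> v /mapP[t ts ->]; apply: sep.
set p2 := lin p a2 in h2.
have cop : coprimep p1 p2.
  apply/Pdiv.ClosedField.coprimepP => t; rewrite hs => ts.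
  have := h2 _ (map_f _ ts); rewrite dot_bmap hform_affine //; exact: size_lin.
have [a0 a0x] := nonvanishing_form x0.
pose p0 := lin p a0.
have : forall j : 'I_d.+1, exists uv : {poly K} * {poly K},
    [/\ (size uv.1 <= d.+1)%N, (size uv.2 <= d.+1)%N
      & 'X^j * p0 = uv.1 * p1 + uv.2 * p2].
  move=> j; have [||u [v h]] := @bezout_size _ d p1 p2 ('X^j * p0) cop s1.
  - exact: size_lin.
  - apply: leq_trans (size_polyMleq _ _) _; rewrite size_polyXn.
    rewrite addSn /= [leqRHS]addSnnS; apply: leq_add; first by rewrite -ltnS.
    exact: size_lin.
  by exists (u, v).
move=> /fin_all_exists[w hw].
pose M := \matrix_(k < d.+1, j < d.+1) ((k == j)%:R *: mlin a0
  - ((w j).1)`_k *: mlin a1 - ((w j).2)`_k *: mlin a2).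
have MxE (z : 'rV[K]_N) k j : (M k j).@[z 0] = (k == j)%:R * dot a0 z
    - ((w j).1)`_k * dot a1 z - ((w j).2)`_k * dot a2 z.
  by rewrite mxE !mevalB !mevalZ !meval_mlin.
have : (\det M).@[x 0] = 0.
  apply: (hx d.+1) => [|_ [_ [y y0 ->]]].
    by apply: det_dhomog => k j; rewrite mxE !rpredB ?rpredZ ?mlin_homog.
  rewrite -det_map_mx; apply/eqP/det0P.
  (* the kernel vector of the values of the monomials of degree [d] at [y] *)
  pose b : 'rV[K]_d.+1 := \row_k (y 0 0 ^+ (d - k) * y 0 1 ^+ k).
  have formE (f : {poly K}) : \sum_(k < d.+1) f`_k * b 0 k = hform d f y.
    by apply: eq_bigr => k _; rewrite mxE.
  exists b.
    apply: contraTneq y0 => /rowP b0; rewrite negbK [y]ptE.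
    have := b0 ord0; have := b0 ord_max; rewrite !mxE /= subnn subn0 !mul1r !mulr1.
    by move=> /eqP; rewrite expf_eq0 => /andP[_ /eqP->] /eqP; rewrite expf_eq0 => /andP[_ /eqP->];
      rewrite -[_ == _]negbK pt_neq0 eqxx.
  apply/rowP => j; rewrite [RHS]mxE mxE.
  under eq_bigr => k _ do rewrite [map_mx _ _ _ _]mxE /= MxE !mulrBr !dot_bmap.
  rewrite !sumrB -/p0 -/p1 -/p2.
  have EX : \sum_(k < d.+1) b 0 k * ((k == j)%:R * hform d.+1 p0 y) = hform d 'X^j y * hform d.+1 p0 y.
    rewrite -formE mulr_suml; apply: eq_bigr => k _.
    by rewrite coefXn mulrA [b 0 k * _]mulrC.
  have EU (f g : {poly K}) : \sum_(k < d.+1) b 0 k * (f`_k * hform d.+1 g y) = hform d f y * hform d.+1 g y.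
    by rewrite -formE mulr_suml; apply: eq_bigr => k _; rewrite mulrA [b 0 k * _]mulrC.
  rewrite EX !EU; have [su sv E] := hw j.
  rewrite -!hformM //; try exact: size_lin; last by rewrite size_polyXn.
  rewrite E; apply/eqP; rewrite -addrA -opprD subr_eq0; apply/eqP.
  rewrite -[X in hform _ (X + _)]scale1r -[X in hform _ (_ + X)]scale1r.
  pose F (i : bool) := if i then (w j).1 * p1 else (w j).2 * p2.
  have := hform_sum (d + d.+1) (fun _ : bool => 1) F y.
  by rewrite !big_bool /= !mul1r.
rewrite -det_map_mx.
have -> : map_mx (meval (x 0)) M = (dot a0 x)%:M.
  apply/matrixP => k j; rewrite [LHS]mxE /= MxE a1x a2x !mulr0 !subr0 mxE.
  by rewrite mulr_natl.
by rewrite det_scalar => /eqP; rewrite expf_eq0 (negPf a0x) andbF.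
Qed.

(** * The degree of a parametrized curve *)

Lemma lead_coef_map_neq0 (R S : nzRingType) (f : {rmorphism R -> S})
    (P : {poly R}) (e : nat) :
  (size P <= e.+1)%N -> f P`_e != 0 -> f (lead_coef P) != 0.
Proof.
move=> sP fe; suff -> : lead_coef P = P`_e by [].
rewrite /lead_coef; congr nth; apply/eqP; rewrite -eqSS.
have P0 : P != 0 by apply: contraNneq fe => ->; rewrite coef0 rmorph0.
rewrite prednK ?size_poly_gt0 // eqn_leq sP ltnNge.
by apply: contra fe => /leq_sizeP->; rewrite ?rmorph0.
Qed.

(** In the pencil spanned by two coprime forms, the members with a multiple
    root correspond to the zeros of the Wronskian, hence are finitely many. *)
Lemma separable_member (K : closedFieldType) (charK : [pchar K] =i pred0)
    (d N : nat) (p : 'I_N -> {poly K}) :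
  (0 < d)%N -> (forall k, size (p k) <= d.+1)%N -> basepoint_free d p ->
  exists a, (lin p a)`_d != 0 /\
    forall t, root (lin p a) t -> ~~ root (lin p a)^`() t.
Proof.
move=> d0 sp bpf.
have [|a1 a1d] := @nonvanishing_form _ _ (bmap d p (pt 0 1)).
  by apply: bpf; rewrite pt_neq0 oner_eq0 orbT.
rewrite dot_bmap hform_infty in a1d; set p1 := lin p a1 in a1d.
have p10 : p1 != 0 by apply: contraNneq a1d => ->; rewrite coef0.
have [s1 hs1] := closed_root_seq p10.
have [|a2 [_ h2]] := @simultaneous_form _ _ 0 [seq bmap d p (pt 1 t) | t <- s1].
  move=> v /mapP[t _ ->]; have [|a ha] := @nonvanishing_form _ _ (bmap d p (pt 1 t)).
    by apply: bpf; rewrite pt_neq0 oner_eq0.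
  by exists a; split=> //; rewrite /dot big1 // => i _; rewrite mxE mulr0.
set p2 := lin p a2 in h2.
have cop t : root p1 t -> p2.[t] != 0.
  rewrite hs1 => ts; have := h2 _ (map_f _ ts).
  by rewrite dot_bmap hform_affine //; apply: size_lin.
pose W := p2^`() * p1 - p2 * p1^`().
have W0 : W != 0.
  rewrite subr_eq0; apply: contraNneq a1d => E.
  have : p1 %| p2 * p1^`() by rewrite -E dvdp_mull.
  rewrite Gauss_dvdpr; last exact/Pdiv.ClosedField.coprimepP.
  have [E'|n0] := eqVneq p1^`() 0; last first.
    by move=> /dvdp_leq-/(_ n0); rewrite leqNgt lt_size_deriv.
  have := congr1 (fun f : {poly K} => f`_d.-1) E'.
  rewrite coef_deriv prednK // coef0 -mulr_natr => /eqP.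
  by rewrite mulf_eq0 ((pcharf0P K).1 charK) (gtn_eqF d0) orbF => ->.
have [s hs] := closed_root_seq W0.
pose f (c : K * K) : {poly K} := c.1%:P + c.2 *: 'X.
have f0 c : (c.1 != 0) || (c.2 != 0) -> f c != 0.
  apply: contraTneq => E; rewrite -negb_and negbK; apply/andP; split; apply/eqP.
    by have := congr1 (fun g : {poly K} => g`_0) E; rewrite coefD coefC coefZ coefX coef0 mulr0 addr0.
  by have := congr1 (fun g : {poly K} => g`_1) E; rewrite coefD coefC coefZ coefX coef0 mulr1 add0r.
have [|c] := @exists_nonroot K (\prod_(x <- (p2`_d, p1`_d) :: [seq (p2.[t], p1.[t]) | t <- s]) f x).
  apply: prod_neq0 => x; rewrite inE => /orP[/eqP->|/mapP[t _ ->]]; apply: f0 => /=.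
    by rewrite a1d orbT.
  by case: (eqVneq p1.[t] 0) => [/eqP/cop->|_]; rewrite ?orbT.
rewrite horner_prod => /prod_neq0P hc.
have fE x : (f x).[c] = x.1 + c * x.2.
  by rewrite hornerD hornerC hornerZ hornerX mulrC.
have linE : lin p (a2 + c *: a1) = p2 + c *: p1.
  rewrite /p2 /p1 /lin scaler_sumr -big_split; apply: eq_bigr => k _ /=.
  by rewrite !mxE scalerDl scalerA.
exists (a2 + c *: a1); rewrite linE; split.
  by have := hc _ (mem_head _ _); rewrite fE coefD coefZ.
move=> t /rootP; rewrite hornerD hornerZ => E1; apply/negP => /rootP.
rewrite derivD derivZ hornerD hornerZ => E2.
have : root W t.
  rewrite rootE /W hornerD hornerN !hornerM.
  move/eqP: E1; rewrite addr_eq0 => /eqP->.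
  move/eqP: E2; rewrite addr_eq0 => /eqP->.
  by apply/eqP; ring.
rewrite hs => ts; have := hc (p2.[t], p1.[t]).
by rewrite inE (map_f (fun t => (p2.[t], p1.[t])) ts) orbT fE /= E1 eqxx => /(_ isT).
Qed.

Lemma generic_lin (K : fieldType) (N : nat) (x : 'rV[K]_N) :
  x != 0 -> generic (fun a => dot a x != 0).
Proof.
move=> /nonvanishing_form[a ha].
have E (b : 'rV[K]_N) : (mlin x).@[b 0] = dot b x.
  by rewrite meval_mlin /dot; apply: eq_bigr => i _; rewrite mulrC.
apply: (@generic_imp _ _ (fun v : 'rV[K]_N => (mlin x).@[v 0] != 0)).
  by move=> v; rewrite E.
by apply: (@generic_value _ _ _ a); rewrite E.
Qed.

Lemma same_point_sym (K : fieldType) (N : nat) (x y : 'rV[K]_N) :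
  same_point x y -> same_point y x.
Proof.
move=> [c c0 ->]; exists c^-1; first by rewrite invr_eq0.
by rewrite scalerA mulVf ?scale1r.
Qed.

Lemma same_point_trans (K : fieldType) (N : nat) (x y z : 'rV[K]_N) :
  same_point x y -> same_point y z -> same_point x z.
Proof.
move=> [c c0 ->] [e e0 ->]; exists (c * e); first by rewrite mulf_neq0.
by rewrite scalerA.
Qed.

Lemma same_point_pt (K : fieldType) (t t' : K) :
  same_point (pt 1 t) (pt 1 t') -> t = t'.
Proof.
move=> [c _ /rowP E]; have := E 1; have := E 0; rewrite !mxE /= mulr1 => <-.
by rewrite mul1r.
Qed.

(** A general hyperplane pulls back to a form of degree [d] with [d] distinct
    roots, all of them in the locus where the parametrization is injective. *)
Theorem degree_param (K : closedFieldType) (charK : [pchar K] =i pred0)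
    (d N : nat) (p : 'I_N -> {poly K}) :
  (0 < d)%N -> (forall k, size (p k) <= d.+1)%N -> basepoint_free d p ->
  generically_injective (bmap d p) ->
  curve_degree (zariski_closure (param_image d p)) d.
Proof.
move=> d0 sp bpf [g g0 ginj].
have inf0 : pt 0 1 != 0 :> 'rV[K]_2 by rewrite pt_neq0 oner_eq0 orbT.
have aff0 t : pt 1 t != 0 :> 'rV[K]_2 by rewrite pt_neq0 oner_eq0.
have [s hs] := closed_root_seq g0.
have C1 := generic_lin (bpf _ inf0).
have C2 : generic (fun a => forall t, t \in s -> dot a (bmap d p (pt 1 t)) != 0).
  by apply: generic_all => t _; apply: generic_lin; apply: bpf.
pose P : {poly {mpoly K[N]}} := \sum_k 'X_k *: map_poly (@mpolyC N K) (p k).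
have PE (a : 'rV[K]_N) : map_poly (meval (a 0)) P = lin p a.
  rewrite /P rmorph_sum; apply: eq_bigr => k _ /=.
  rewrite map_polyZ /= mevalXU -map_poly_comp; congr (_ *: _).
  by apply: map_poly_id => x _; rewrite /= mevalC.
have C3 : generic (fun a => forall t, root (lin p a) t -> ~~ root (lin p a)^`() t).
  have [w [wd wsep]] := separable_member charK d0 sp bpf.
  have sP : (size P <= d.+1)%N.
    apply: leq_trans (size_sum _ _ _) _; apply/bigmax_leqP => k _.
    apply: leq_trans (size_scale_leq _ _) _.
    exact: leq_trans (size_poly _ _) (sp k).
  have PdE : (P`_d).@[w 0] = (lin p w)`_d by rewrite -PE coef_map.
  have := @generic_no_common_root K N P P^`() w; rewrite /= -deriv_map !PE => H.
  apply: generic_imp (H _ _ wsep) => [a||].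
  - by rewrite -deriv_map PE.
  - by apply: lead_coef_map_neq0 sP _; rewrite /= PdE.
  have P0 : P != 0 by apply: contraNneq wd => P0; rewrite -PdE P0 coef0 meval0.
  apply: (@lead_coef_map_neq0 _ _ _ _ d.-1).
    by rewrite prednK // -ltnS (leq_trans (lt_size_deriv P0)).
  rewrite coef_deriv prednK //= raddfMn /= PdE -mulr_natr mulf_neq0 //.
  by rewrite ((pcharf0P K).1 charK) (gtn_eqF d0).
apply: generic_imp (generic_and C1 (generic_and C2 C3)) => a [aInf [abad asep]] _ H.
rewrite dot_bmap hform_infty in aInf.
set h := lin p a in aInf asep.
have sh : size h = d.+1.
  apply/eqP; rewrite eqn_leq size_lin //= ltnNge.
  by apply: contra aInf => /leq_sizeP->.
have [r hr] := closed_field_poly_normal h.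
have h0 : lead_coef h != 0 by rewrite lead_coef_eq0 -size_poly_eq0 sh.
have sr : size r = d.
  by have := sh; rewrite hr size_scale // size_prod_XsubC => -[].
have rootE t : root h t = (t \in r) by rewrite hr rootZ // root_prod_XsubC.
have ur : uniq r.
  rewrite -separable_prod_XsubC.
  rewrite -(@eqp_separable _ h); last by rewrite [X in X %= _]hr eqp_scale.
  rewrite unlock; exact/Pdiv.ClosedField.coprimepP.
have dotE t : dot a (bmap d p (pt 1 t)) = h.[t].
  by rewrite dot_bmap hform_affine //; apply: size_lin.
have good t : t \in r -> g.[t] != 0.
  move=> tr; apply: contraTneq tr => /rootP; rewrite hs => /abad.
  by rewrite dotE -rootE.
exists (fun i => bmap d p (pt 1 (r`_i))); split.
- move=> i; have ir : r`_i \in r by rewrite mem_nth ?sr.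
  split; last by rewrite /H -/(dot _ _) dotE; apply/rootP; rewrite rootE.
  split; first exact: bpf.
  by move=> k q _; apply; split; [apply: bpf | exists (pt 1 r`_i)].
- move=> i j Eij; apply/val_inj/eqP.
  rewrite -(nth_uniq 0 _ _ ur) ?sr; [apply/eqP | exact: ltn_ord | exact: ltn_ord].
  apply: same_point_pt; apply: (ginj _ _ _ _ Eij) => //.
  by apply: good; rewrite mem_nth ?sr.
move=> x Cx Hx.
have [y y0 xy] := param_image_closed d0 sp bpf Cx.
have hy : dot a (bmap d p y) = 0.
  case: (same_point_sym xy) => c c0 ->; rewrite dotZr.
  by rewrite [dot _ _]Hx mulr0.
case: (pt_cases y0) => [[c [t [c0 Ey]]]|[c c0 Ey]]; last first.
  move/eqP: hy; rewrite Ey dot_bmap hformZ hform_infty mulf_eq0 expf_eq0.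
  by rewrite (negPf c0) andbF (negPf aInf).
move/eqP: hy; rewrite Ey bmapZ dotZr dotE mulf_eq0 expf_eq0 (negPf c0) andbF /=.
rewrite -[_ == 0]/(root h t) rootE => tr.
have ti : (index t r < d)%N by rewrite -sr index_mem.
exists (Ordinal ti); rewrite /= nth_index //.
apply: same_point_trans xy _; exists (c ^+ d); first by rewrite expf_neq0.
by rewrite Ey bmapZ.
Qed.

(** Two degrees count the points on a common general hyperplane. *)
Lemma curve_degree_unique (K : closedFieldType) (N : nat)
    (C : 'rV[K]_N -> Prop) (d e : nat) :
  (0 < N)%N -> curve_degree C d -> curve_degree C e -> d = e.
Proof.
case: N C => // N C _ Cd Ce.
have X0 : generic (fun a : 'rV[K]_N.+1 => a != 0).
  have [|G G0 hG] := @generic_lin K N.+1 (delta_mx 0 0).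
    by apply/eqP => /rowP/(_ 0); rewrite !mxE !eqxx => /eqP; rewrite oner_eq0.
  exists G => // a /hG; apply: contraNneq => ->.
  by rewrite /dot big1 // => i _; rewrite mxE mul0r.
have [a [a0 [/(_ a0)[s [s1 s2 s3]] /(_ a0)[t [t1 t2 t3]]]]] :=
  generic_exists (generic_and X0 (generic_and Cd Ce)).
have le (m k : nat) (u : 'I_m -> 'rV[K]_N.+1) (v : 'I_k -> 'rV[K]_N.+1) :
    (forall i j, same_point (u i) (u j) -> i = j) ->
    (forall i, exists j, same_point (u i) (v j)) -> (m <= k)%N.
  move=> uinj /fin_all_exists[f hf].
  rewrite -[m]card_ord -[k]card_ord; apply: (@leq_card _ _ f) => i j Eij.
  apply: uinj; apply: same_point_trans (hf i) _; rewrite Eij.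
  exact: same_point_sym.
apply/eqP; rewrite eqn_leq (le _ _ s t) ?(le _ _ t s) //.
  by move=> i; have [Ci Hi] := t1 i; apply: s3.
by move=> i; have [Ci Hi] := s1 i; apply: t3.
Qed.

(** * Curves of Cayley structures *)

Definition form_poly (K : fieldType) (m : nat) (f : 'M[K]_(m, 2)) (i : 'I_m) :
  {poly K} := (f i 0)%:P + f i 1 *: 'X.

Lemma size_form_poly (K : fieldType) (m : nat) (f : 'M[K]_(m, 2)) i :
  (size (form_poly f i) <= 2)%N.
Proof.
apply: leq_trans (size_polyD _ _) _; rewrite geq_max size_polyC.
rewrite (leq_trans (size_scale_leq _ _)) ?size_polyX // andbT.
by case: (_ != 0).
Qed.

Lemma hform_form_poly (K : fieldType) (m : nat) (f : 'M[K]_(m, 2)) i y :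
  hform 1 (form_poly f i) y = lform f i y.
Proof.
rewrite /hform !big_ord_recl big_ord0 addr0 /form_poly !coefD !coefC !coefZ.
by rewrite !coefX /= mulr0 addr0 add0r !mulr1 mul1r.
Qed.

Lemma hform_prod (K : fieldType) (m : nat) (f : 'M[K]_(m, 2))
    (e : 'I_m -> nat) (y : 'rV[K]_2) :
  (size (\prod_i form_poly f i ^+ e i)%R <= (\sum_i e i).+1)%N /\
  hform (\sum_i e i) (\prod_i form_poly f i ^+ e i) y = \prod_i lform f i y ^+ e i.
Proof.
pose R (k : nat) (P : {poly K}) (v : K) := (size P <= k.+1)%N /\ hform k P y = v.
have RM k k' P P' v v' : R k P v -> R k' P' v' -> R (k + k')%N (P * P') (v * v').
  move=> [sP EP] [sP' EP']; split; last by rewrite hformM // EP EP'.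
  apply: leq_trans (size_polyMleq _ _) _.
  by rewrite -subn1 leq_subLR add1n -addSn -addnS leq_add.
have R1 : R 0%N 1 1 by split; rewrite ?size_poly1 ?hform1.
suff : R (\sum_i e i)%N (\prod_i form_poly f i ^+ e i) (\prod_i lform f i y ^+ e i) by [].
elim/big_rec3: _ => // i k P v _; apply: (RM).
elim: (e i) => [|j IH]; first by rewrite !expr0.
rewrite !exprS -add1n; apply: (RM) => //.
by split; [apply: size_form_poly | apply: hform_form_poly].
Qed.

Definition curve_poly (K : fieldType) (n l : nat) (A tau : {fset 'rV[int]_n})
    (pi : 'rV[int]_n -> 'rV[int]_l.+1) (f : 'M[K]_(l.+1, 2)) (k : 'I_#|` A|) :
    {poly K} :=
  let u := nth 0 (enum_fset A) k in
  if u \in tau then \prod_i form_poly f i ^+ absz (pi u 0 i) else 0.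

Arguments curve_poly {K n l} A tau pi f k.

Lemma simplex_absz (l d : nat) (w : 'rV[int]_l.+1) :
  in_simplex d w -> (\sum_i absz (w 0%R i))%N = d.
Proof.
move=> [w0 ws]; apply/eqP; rewrite -(eqr_nat int) natr_sum.
rewrite [d%:R]natz -ws; apply/eqP; apply: eq_bigr => i _.
by rewrite natz gez0_abs.
Qed.

Section CayleyCurve.

Variables (K : fieldType) (n l d : nat) (A tau : {fset 'rV[int]_n}).
Variable pi : 'rV[int]_n -> 'rV[int]_l.+1.
Hypothesis tauA : {subset tau <= A}.
Hypothesis pi_simplex : forall u, u \in tau -> in_simplex d (pi u).
Hypothesis pi_vanish : forall i, exists2 u, u \in tau & pi u 0 i = 0.
Hypothesis pi_support : forall i, exists2 u, u \in tau & pi u 0 i != 0.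

Lemma size_curve_poly (f : 'M[K]_(l.+1, 2)) k :
  (size (curve_poly A tau pi f k) <= d.+1)%N.
Proof.
rewrite /curve_poly; case: ifP => [ut|_]; last by rewrite size_poly0.
rewrite -(simplex_absz (pi_simplex ut)).
by have [] := hform_prod f (fun i => absz (pi (nth 0 (enum_fset A) k) 0 i)) 0.
Qed.

Lemma curve_paramE (f : 'M[K]_(l.+1, 2)) y :
  curve_param A tau pi f y = bmap d (curve_poly A tau pi f) y.
Proof.
apply/rowP => k; rewrite !mxE /curve_poly; case: ifP => [ut|_].
  rewrite -(simplex_absz (pi_simplex ut)).
  by have [_ ->] := hform_prod f (fun i => absz (pi (nth 0 (enum_fset A) k) 0 i)) y.
by rewrite /hform big1 // => i _; rewrite coef0 mul0r.
Qed.

Lemma curve_param_coord (f : 'M[K]_(l.+1, 2)) u : u \in tau ->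
  exists k, forall y, curve_param A tau pi f y 0 k
    = \prod_i lform f i y ^+ absz (pi u 0 i).
Proof.
move=> ut; have uA := tauA ut.
have ku : (index u (enum_fset A) < #|` A|)%N by rewrite index_mem.
by exists (Ordinal ku) => y; rewrite mxE /= nth_index // ut.
Qed.

(** At most one form vanishes at a given point, and the corresponding
    coordinate is zero somewhere on [tau]. *)
Lemma curve_basepoint_free (f : 'M[K]_(l.+1, 2)) :
  distinct_roots f -> basepoint_free d (curve_poly A tau pi f).
Proof.
move=> df y y0; rewrite -curve_paramE.
have [u ut hu] : exists2 u, u \in tau &
    forall i, lform f i y = 0 -> pi u 0 i = 0.
  have [/existsP[i /eqP fi]|/existsPn h] := boolP [exists i, lform f i y == 0].
    have [u ut hu] := pi_vanish i; exists u => // j fj.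
    by case: (eqVneq i j) => [<-//|/df/(_ y y0 fi)]; rewrite fj eqxx.
  have [u ut _] := pi_vanish ord0; exists u => // i /eqP fi.
  by have := h i; rewrite fi.
have [k hk] := curve_param_coord f ut.
apply/eqP => /rowP/(_ k); rewrite hk mxE; apply/eqP/prodf_neq0 => i _.
case: (eqVneq (lform f i y) 0) => [fi|fi]; last exact: expf_neq0.
by rewrite hu // expr0 oner_neq0.
Qed.

(** The character of the torus with exponent [v]. *)
Definition chi (m : nat) (t : 'I_m -> K) (v : 'rV[int]_m) : K :=
  \prod_k t k ^ v 0 k.

Lemma chiD m (t : 'I_m -> K) v w : (forall k, t k != 0) ->
  chi t (v + w) = chi t v * chi t w.
Proof.
by move=> t0; rewrite -big_split; apply: eq_bigr => k _ /=; rewrite mxE expfzDr.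
Qed.

Lemma chi0 m (t : 'I_m -> K) : chi t 0 = 1.
Proof. by rewrite /chi big1 // => k _; rewrite mxE expr0z. Qed.

Lemma chiN m (t : 'I_m -> K) v : (forall k, t k != 0) ->
  chi t (- v) = (chi t v)^-1.
Proof.
move=> t0; have h : chi t v * chi t (- v) = 1 by rewrite -chiD // subrr chi0.
have cv : chi t v != 0.
  by apply: contraNneq (oner_neq0 K) => E; rewrite -h E mul0r.
by apply: (mulfI cv); rewrite h divff.
Qed.

Lemma chiMz m (t : 'I_m -> K) v (k : int) : (forall k, t k != 0) ->
  chi t v = 1 -> chi t (v *~ k) = 1.
Proof.
move=> t0 h; have hn (j : nat) : chi t (v *+ j) = 1.
  by elim: j => [|j IH]; rewrite ?mulr0n ?chi0 // mulrS chiD // h IH mulr1.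
by case: k => k; rewrite /intmul ?chiN // hn ?invr1.
Qed.

(** Two points of the parameter line with the same image, one of them off the
    coordinate hyperplanes, differ by a torus element on which the characters
    of the difference lattice are trivial. *)
Lemma same_image_chi (f : 'M[K]_(l.+1, 2)) y z :
  (forall k, lform f k y != 0) ->
  same_point (curve_param A tau pi f z) (curve_param A tau pi f y) ->
  let t k := lform f k z / lform f k y in
  (forall k, t k != 0) /\
  forall u v, u \in tau -> v \in tau -> chi t (pi u - pi v) = 1.
Proof.
move=> fy [c c0 E] t.
have Ec u : u \in tau -> \prod_i lform f i z ^+ absz (pi u 0 i) =
    c * \prod_i lform f i y ^+ absz (pi u 0 i).
  move=> ut; have [k hk] := curve_param_coord f ut.
  by rewrite -!hk E mxE.
have fz k : lform f k z != 0.
  have [u ut hu] := pi_support k; apply: contra_eq_neq (Ec _ ut) => fk.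
  rewrite (bigD1 k) //= fk expr0n absz_eq0 (negPf hu) mul0r eq_sym.
  by rewrite mulf_neq0 //; apply/prodf_neq0 => i _; apply: expf_neq0.
have t0 k : t k != 0 by rewrite mulf_neq0 ?invr_eq0.
split=> // u v ut vt.
have hc w : w \in tau -> chi t (pi w) = c.
  move=> wt; have /(congr1 (fun x => x / \prod_i lform f i y ^+ absz (pi w 0 i))) := Ec w wt.
  rewrite mulfK; last by apply/prodf_neq0 => i _; apply: expf_neq0.
  move=> <-; rewrite -prodf_div; apply: eq_bigr => k _.
  have [w0 _] := pi_simplex wt.
  by rewrite -[in LHS](gez0_abs (w0 k)) -exprnP expr_div_n.
by rewrite chiD // chiN // !hc // divff.
Qed.

End CayleyCurve.

Lemma zariski_closure_ext (K : fieldType) (N : nat) (S T : 'rV[K]_N -> Prop) x :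
  (forall y, S y <-> T y) -> zariski_closure S x <-> zariski_closure T x.
Proof.
move=> ST; split=> -[x0 h]; split=> // k p hp hS; apply: h hp _ => y /ST; exact: hS.
Qed.

Lemma curve_degree_ext (K : fieldType) (N d : nat) (C D : 'rV[K]_N -> Prop) :
  (forall x, C x <-> D x) -> curve_degree C d -> curve_degree D d.
Proof.
move=> CD; apply: generic_imp => a h a0; have [s [s1 s2 s3]] := h a0.
exists s; split=> // [i|x /CD Cx Hx]; last exact: s3.
by have [/CD ? ?] := s1 i.
Qed.

Lemma cayley_curve_degree (K : closedFieldType) (charK : [pchar K] =i pred0)
    (n l d : nat) (A tau : {fset 'rV[int]_n}) (pi : 'rV[int]_n -> 'rV[int]_l.+1)
    (f : 'M[K]_(l.+1, 2)) :
  (0 < d)%N -> {subset tau <= A} ->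
  (forall u, u \in tau -> in_simplex d (pi u)) ->
  (forall i, exists2 u, u \in tau & pi u 0 i = 0) ->
  distinct_roots f -> generically_injective (curve_param A tau pi f) ->
  curve_degree (curve A tau pi f) d.
Proof.
move=> d0 tauA sim van df [g g0 inj].
have E := curve_paramE A sim f.
apply: (@curve_degree_ext _ _ _ (zariski_closure (param_image d (curve_poly A tau pi f)))).
  move=> x; apply: zariski_closure_ext => y.
  by split=> -[y0 [w w0 Ey]]; split=> //; exists w; rewrite ?E // -E.
apply: degree_param => //.
- exact: size_curve_poly sim f.
- exact: curve_basepoint_free.
by exists g => // t z gt z0; rewrite -!E; apply: inj.
Qed.

(** * Generic injectivity: length one *)

Lemma lformDZ (K : fieldType) (m : nat) (f : 'M[K]_(m, 2)) i (y z : 'rV[K]_2) c :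
  lform f i (z - c *: y) = lform f i z - c * lform f i y.
Proof. by rewrite /lform !mxE; ring. Qed.

Lemma horner_form_poly (K : fieldType) (m : nat) (f : 'M[K]_(m, 2)) i t :
  (form_poly f i).[t] = lform f i (pt 1 t).
Proof. by rewrite -(@hform_affine _ 1) ?size_form_poly ?hform_form_poly. Qed.

Lemma form_poly_neq0 (K : fieldType) (m : nat) (f : 'M[K]_(m, 2)) i :
  row i f != 0 -> form_poly f i != 0.
Proof.
apply: contraNneq => E; apply/eqP/rowP => j; rewrite !mxE.
have E0 : (form_poly f i)`_0 = 0 by rewrite E coef0.
have E1 : (form_poly f i)`_1 = 0 by rewrite E coef0.
move: E0 E1; rewrite /form_poly !coefD !coefC !coefZ !coefX /=.
rewrite mulr0 mulr1 addr0 add0r => E0 E1.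
by case: j => [[|[|]]] //= h; [rewrite -[RHS]E0 | rewrite -[RHS]E1];
  congr (f i _); apply/val_inj.
Qed.

Lemma expr_gcd1 (K : fieldType) (x : K) (a b : nat) :
  x ^+ a = 1 -> x ^+ b = 1 -> x ^+ gcdn a b = 1.
Proof.
move=> xa xb; case: (posnP a) => [->|a0]; first by rewrite gcd0n.
have [k _ /dvdnP[q E]] := Bezoutl b a0.
have : x ^+ (gcdn a b + k * b) = 1 by rewrite E mulnC exprM xa expr1n.
by rewrite exprD mulnC exprM xb expr1n mulr1.
Qed.

(** In length one, two points with the same image have [f_1 / f_0] equal up to
    a scalar all of whose powers by exponent differences are trivial. *)
Lemma length_one_injective (K : fieldType) (n d : nat) (A tau : {fset 'rV[int]_n})
    (pi : 'rV[int]_n -> 'rV[int]_2) (f : 'M[K]_(2, 2)) :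
  {subset tau <= A} ->
  (forall u, u \in tau -> in_simplex d (pi u)) ->
  (forall i, exists2 u, u \in tau & pi u 0 i != 0) ->
  (forall m : nat, (forall u v, u \in tau -> v \in tau ->
     (m%:Z %| (pi u - pi v) ord0 1%R)%Z) -> m = 1%N) ->
  nonzero_forms f -> distinct_roots f ->
  generically_injective (curve_param A tau pi f).
Proof.
move=> tauA sim sup unim nzf df.
exists (form_poly f 0 * form_poly f 1); first by rewrite mulf_neq0 ?form_poly_neq0.
move=> s z; rewrite hornerM mulf_eq0 negb_or !horner_form_poly => /andP[y0 y1] _.
set y := pt 1 s in y0 y1 *.
have fy k : lform f k y != 0.
  case: k => [[|[|]]] //= h; [move: y0 | move: y1];
    by congr (lform f _ y != 0); apply/val_inj.
move=> /(same_image_chi tauA sim sup fy); set t := fun k => _ => -[t0 ht].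
pose x := t 1 / t 0.
have x0 : x != 0 by rewrite mulf_neq0 ?invr_eq0.
have sum0 u : u \in tau -> pi u 0 0 = d%:Z - pi u 0 1.
  move=> /sim[_]; rewrite !big_ord_recl big_ord0 addr0 => <-.
  rewrite (_ : lift ord0 ord0 = 1); last exact/val_inj.
  by rewrite addrK.
have hx u v : u \in tau -> v \in tau -> x ^ (pi u - pi v) 0 1 = 1.
  move=> ut vt; rewrite -(ht u v ut vt) /chi !big_ord_recl big_ord0 mulr1.
  rewrite (_ : lift ord0 ord0 = 1); last exact/val_inj.
  have -> : (pi u - pi v) 0 ord0 = - (pi u - pi v) 0 1.
    by rewrite !mxE (sum0 _ ut) (sum0 _ vt); ring.
  by rewrite /x expfzMl exprz_inv mulrC.
have [u0 u0t _] := sup 0.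
pose k u : int := (pi u - pi u0) 0 1.
pose m := \big[gcdn/0%N]_(u <- tau) absz (k u).
have xm : x ^+ m = 1.
  rewrite /m big_seq; apply: (@big_ind _ (fun k => x ^+ k = 1)) => // [a b|u ut].
    exact: expr_gcd1.
  have := hx _ _ ut u0t; rewrite -/(k u); case: (k u) => j //= /(congr1 GRing.inv).
  by rewrite invrK invr1.
have m1 : m = 1%N.
  apply: unim => u v ut vt.
  have md w : w \in tau -> (m%:Z %| (pi w - pi u0) ord0 1%R)%Z.
    move=> wt; rewrite -/(k w) /m dvdzE /=.
    by rewrite (big_rem w) //= dvdn_gcdl.
  have -> : (pi u - pi v) ord0 1 = (pi u - pi u0) ord0 1 - (pi v - pi u0) ord0 1.
    by rewrite !mxE; ring.
  by rewrite rpredB ?md.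
have t01 : t 1 = t 0.
  by move: xm; rewrite m1 expr1 /x => /(congr1 (fun a => a * t 0)); rewrite divfK ?mul1r.
exists (t 0) => //; apply/eqP; rewrite -subr_eq0; apply/negP => /negP nz.
have E0 : lform f 0 (z - t 0 *: y) = 0 by rewrite lformDZ divfK ?subrr.
have : lform f 1 (z - t 0 *: y) != 0 by apply: (df 0 1 _ _ nz E0).
by rewrite lformDZ -t01 divfK ?subrr ?eqxx.
Qed.

(** * Generic injectivity: rank at least two *)

Definition posp (a : int) : nat := if 0 <= a then absz a else 0.
Definition negp (a : int) : nat := posp (- a).

Lemma pospBnegp (a : int) : (posp a)%:Z - (negp a)%:Z = a.
Proof. by rewrite /negp /posp; do 2!case: ifP; lia. Qed.

Lemma pospDnegp (a : int) : (posp a + negp a)%N = absz a.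
Proof. by rewrite /negp /posp; do 2!case: ifP; lia. Qed.

Lemma posp_negp (a : int) : posp a = 0%N \/ negp a = 0%N.
Proof. by rewrite /negp /posp; do 2!case: ifP; lia. Qed.

Definition root_poly (R : comNzRingType) (m : nat) (c : 'I_m -> R)
    (e : 'I_m -> nat) : {poly R} := \prod_k ('X + (c k)%:P) ^+ e k.

Lemma root_poly_top (R : comNzRingType) (m : nat) (c : 'I_m -> R)
    (e : 'I_m -> nat) :
  (size (root_poly c e - 'X^(\sum_k e k))%R <= \sum_k e k)%N /\
  (root_poly c e * 'X)`_(\sum_k e k) = \sum_k c k *+ e k.
Proof.
pose T (E : nat) (p : {poly R}) (s : R) :=
  (size (p - 'X^E)%R <= E)%N /\ (p * 'X)`_E = s.
have TM E F p q s s' : T E p s -> T F q s' -> T (E + F)%N (p * q) (s + s').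
  move=> [sp Ep] [sq Eq]; set p1 := p - _ in sp; set q1 := q - _ in sq.
  have pE : p = 'X^E + p1 by rewrite addrC subrK.
  have qE : q = 'X^F + q1 by rewrite addrC subrK.
  clearbody p1 q1.
  have top (G : nat) : ('X^G * 'X : {poly R})`_G = 0.
    by rewrite -exprSr coefXn ltn_eqF.
  have Ep1 : (p1 * 'X)`_E = s by rewrite -Ep pE mulrDl coefD top add0r.
  have Eq1 : (q1 * 'X)`_F = s' by rewrite -Eq qE mulrDl coefD top add0r.
  have E' : p * q = 'X^(E + F)%N + ('X^E * q1 + 'X^F * p1 + p1 * q1).
    by rewrite pE qE exprD; ring.
  have low : (size (p1 * q1 * 'X)%R <= E + F)%N.
    have [->|n0] := eqVneq (p1 * q1) 0; first by rewrite mul0r size_poly0.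
    rewrite size_mulX //; apply: leq_ltn_trans (size_polyMleq _ _) _.
    have : size p1 != 0%N by apply: contraNneq n0 => /eqP; rewrite size_poly_eq0 => /eqP->; rewrite mul0r.
    by lia.
  split.
    rewrite E' addrAC subrr add0r.
    have sX G H (r : {poly R}) : (size r <= H)%N -> (size ('X^G * r)%R <= G + H)%N.
      move=> sr; apply: leq_trans (size_polyMleq _ _) _.
      by rewrite size_polyXn addSn /= leq_add2l.
    apply: leq_trans (size_polyD _ _) _; rewrite geq_max; apply/andP; split.
      apply: leq_trans (size_polyD _ _) _; rewrite geq_max sX //=.
      by rewrite addnC sX.
    have [->|n0] := eqVneq (p1 * q1) 0; first by rewrite size_poly0.
    by apply: leq_trans low; rewrite size_mulX.
  rewrite E' mulrDl coefD top add0r !mulrDl !coefD [(p1 * q1 * 'X)`__]nth_default //.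
  rewrite addr0 -!mulrA !coefXnM -if_neg -leqNgt leq_addr addKn Eq1.
  by rewrite -if_neg -leqNgt leq_addl addnK Ep1 addrC.
have T0 : T 0%N 1 0.
  by split; rewrite ?expr0 ?subrr ?size_poly0 // mul1r coefX.
suff : T (\sum_k e k)%N (root_poly c e) (\sum_k c k *+ e k) by [].
rewrite /root_poly; elim/big_rec3: _ => // k s p E _; apply: (TM).
elim: (e k) => [|j IH]; first by rewrite expr0 mulr0n.
rewrite exprS mulrS -add1n; apply: (TM) IH; split.
  by rewrite expr1 addrAC subrr add0r size_polyC; case: (_ != 0).
by rewrite mulrDl coefD -expr2 coefXn coefMX coefC add0r.
Qed.

(** The equation in [s] saying that the character [v] is trivial at
    [(s + c_k)_k], cleared of denominators. *)
Definition character_eqn (R : comNzRingType) (m : nat) (c : 'I_m -> R)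
    (v : 'rV[int]_m) : {poly R} :=
  root_poly c (fun k => posp (v 0 k)) - root_poly c (fun k => negp (v 0 k)).

Definition char_height (m : nat) (v : 'rV[int]_m) : nat := (\sum_k posp (v 0%R k))%N.

Lemma char_heightE (m : nat) (v : 'rV[int]_m) :
  \sum_k v 0 k = 0 -> (\sum_k negp (v 0%R k))%N = char_height v.
Proof.
move=> v0; apply/eqP; rewrite -(eqr_nat int) !natr_sum eq_sym -subr_eq0 -sumrB.
apply/eqP; rewrite -[RHS]v0; apply: eq_bigr => k _; rewrite !natz.
exact: pospBnegp.
Qed.

(** The leading terms cancel, and the next coefficient is a linear form in the
    parameters. *)
Lemma character_eqn_top (R : comNzRingType) (m : nat) (c : 'I_m -> R)
    (v : 'rV[int]_m) :
  \sum_k v 0 k = 0 -> (0 < char_height v)%N ->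
  (size (character_eqn c v) <= (char_height v).-1.+1)%N /\
  (character_eqn c v)`_(char_height v).-1 = \sum_k c k *~ v 0 k.
Proof.
move=> v0 h0; rewrite prednK //.
have [s1 c1] := root_poly_top c (fun k => posp (v 0 k)).
have [s2 c2] := root_poly_top c (fun k => negp (v 0 k)).
rewrite (char_heightE v0) -/(char_height v) in s1 c1 s2 c2 *.
split.
  rewrite /character_eqn -(subrK 'X^(char_height v) (root_poly _ (fun k => posp _))).
  rewrite -addrA; apply: leq_trans (size_polyD _ _) _; rewrite geq_max s1 /=.
  by rewrite -opprB size_polyN.
have cX (p : {poly R}) : p`_(char_height v).-1 = (p * 'X)`_(char_height v).
  by rewrite coefMX (gtn_eqF h0).
rewrite cX /character_eqn mulrBl coefB c1 c2 -sumrB; apply: eq_bigr => k _.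
by rewrite -[in RHS](pospBnegp (v 0 k)) mulrzBr !pmulrn.
Qed.

Lemma map_character_eqn (R S : comNzRingType) (g : {rmorphism R -> S}) (m : nat)
    (c : 'I_m -> R) (v : 'rV[int]_m) :
  map_poly g (character_eqn c v) = character_eqn (g \o c) v.
Proof.
rewrite /character_eqn rmorphB /= /root_poly !rmorph_prod /=.
by congr (_ - _); apply: eq_bigr => k _; rewrite rmorphXn rmorphD /= map_polyX map_polyC.
Qed.

Lemma horner_root_poly (R : comNzRingType) (m : nat) (c : 'I_m -> R)
    (e : 'I_m -> nat) s :
  (root_poly c e).[s] = \prod_k (s + c k) ^+ e k.
Proof.
rewrite horner_prod; apply: eq_bigr => k _.
by rewrite horner_exp hornerD hornerX hornerC.
Qed.

Lemma root_character_eqn (K : fieldType) (m : nat) (c : 'I_m -> K)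
    (v : 'rV[int]_m) s :
  (forall k, s + c k != 0) -> chi (fun k => s + c k) v = 1 ->
  root (character_eqn c v) s.
Proof.
move=> nz E; rewrite rootE hornerD hornerN !horner_root_poly subr_eq0.
apply/eqP; set D := RHS; have D0 : D != 0 by apply/prodf_neq0 => k _; apply: expf_neq0.
have : \prod_k (s + c k) ^+ posp (v 0 k) / D = 1.
  rewrite -[RHS]E /D -prodf_div; apply: eq_bigr => k _.
  by rewrite -[in RHS](pospBnegp (v 0 k)) expfzDr // -invr_expz.
by move=> /(congr1 (fun x => x * D)); rewrite divfK // mul1r.
Qed.

Lemma natr_inj_pchar0 (K : fieldType) : [pchar K] =i pred0 ->
  injective (fun a : nat => a%:R : K).
Proof.
move=> /pcharf0P ch; suff le (a b : nat) : a%:R = b%:R :> K -> (a <= b)%N.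
  by move=> a b E; apply/eqP; rewrite eqn_leq !le.
move=> E; rewrite leqNgt; apply/negP => ba.
have : (a - b)%:R == 0 :> K by rewrite natrB ?E ?subrr // ltnW.
by rewrite ch subn_eq0 leqNgt ba.
Qed.

Lemma power_combination_neq0 (K : fieldType) (r A B : K) (a b : nat) :
  a <> b -> (A != 0) || (B != 0) ->
  A *: ('X + r%:P) ^+ a - B *: ('X + r%:P) ^+ b != 0.
Proof.
move=> ab AB; rewrite subr_eq0.
have sz (C : K) k : C != 0 -> size (C *: ('X + r%:P) ^+ k) = k.+1.
  by move=> C0; rewrite size_scale // -[r]opprK polyCN size_exp_XsubC.
have [A0|A0] := eqVneq A 0; have [B0|B0] := eqVneq B 0.
- by rewrite A0 B0 eqxx in AB.
- by rewrite A0 scale0r eq_sym -size_poly_eq0 sz.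
- by rewrite B0 scale0r -size_poly_eq0 sz.
- by apply: contra_notN ab => /eqP/(congr1 (fun p : {poly K} => size p)); rewrite !sz // => -[].
Qed.

(** With [alpha] blind to the parameter [j] and [beta] blind to [i], the
    parameters can be fixed one after the other: [c_i] keeps the degree of the
    first equation, and then [c_j] moves the zeros of the second equation away
    from the finitely many zeros of the first. *)
Lemma coprime_parameters (K : closedFieldType) (charK : [pchar K] =i pred0)
    (m : nat) (alpha beta : 'rV[int]_m) (i j : 'I_m) :
  alpha 0 i != 0 -> alpha 0 j = 0 -> beta 0 i = 0 -> beta 0 j != 0 ->
  \sum_k alpha 0 k = 0 -> (0 < char_height alpha)%N ->
  exists c : 'I_m -> K,
    [/\ \sum_k c k *~ alpha 0 k != 0, \sum_k c k *~ beta 0 k != 0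
      & forall s, root (character_eqn c alpha) s -> ~~ root (character_eqn c beta) s].
Proof.
move=> ai aj bi bj sa ha.
have intK (z : int) : z != 0 -> z%:~R != 0 :> K.
  by case: z => k k0; rewrite ?NegzE ?mulrNz ?oppr_eq0 -pmulrn ((pcharf0P K).1 charK).
have ij : i != j by apply: contraNneq ai => ->; rewrite aj.
pose c x y k : K := if k == i then x else if k == j then y else (k : nat)%:R.
have cE x y k : k != i -> k != j -> c x y k = (k : nat)%:R.
  by rewrite /c => /negPf-> /negPf->.
have sumE x y (v : 'rV[int]_m) : \sum_k c x y k *~ v 0 k =
    x *~ v 0 i + y *~ v 0 j + \sum_(k | (k != i) && (k != j)) (k : nat)%:R *~ v 0 k.
  rewrite (bigD1 i) //= (bigD1 j) 1?eq_sym //= addrA /c eqxx.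
  rewrite eq_sym (negPf ij) eqxx; congr (_ + _).
  by apply: eq_bigr => k /andP[ki kj]; rewrite (negPf ki) (negPf kj).
(* the leading coefficient of the first equation becomes 1 *)
pose x : K := (1 - \sum_(k | (k != i) && (k != j)) (k : nat)%:R *~ alpha 0 k)
  / (alpha 0 i)%:~R.
have sumA y : \sum_k c x y k *~ alpha 0 k = 1.
  by rewrite sumE aj mulr0z addr0 -[x *~ _]mulrzr /x divfK ?intK // subrK.
pose p := character_eqn (c x 0) alpha.
have pE y : character_eqn (c x y) alpha = p.
  rewrite /p /character_eqn /root_poly; congr (_ - _); apply: eq_bigr => k _;
    (case: (eqVneq k j) => [->|kj]; first by rewrite aj !expr0);
    by rewrite /c (negPf kj).
have p0 : p != 0.
  have [_] := character_eqn_top (c x 0) sa ha.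
  by rewrite sumA -/p => E; apply: contraNneq (oner_neq0 K) => p0; rewrite -E p0 coef0.
have [rs hrs] := closed_root_seq p0.
(* the second equation at [r], as a polynomial [q r] in the parameter [j] *)
pose cof (e : 'I_m -> nat) r : K := \prod_(k | k != j) (r + c x 0 k) ^+ e k.
pose q r : {poly K} := cof (fun k => posp (beta 0 k)) r *: ('X + r%:P) ^+ posp (beta 0 j)
  - cof (fun k => negp (beta 0 k)) r *: ('X + r%:P) ^+ negp (beta 0 j).
have qE r y : (q r).[y] = (character_eqn (c x y) beta).[r].
  have part e : (cof e r *: ('X + r%:P) ^+ e j).[y] = (root_poly (c x y) e).[r].
    rewrite horner_root_poly (bigD1 j) //= hornerZ horner_exp hornerD hornerX hornerC.
    rewrite /c eq_sym (negPf ij) eqxx mulrC addrC; congr (_ * _).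
    by apply: eq_bigr => k kj; rewrite /c (negPf kj).
  by rewrite !hornerD !hornerN !part.
have q0 r : q r != 0.
  apply: power_combination_neq0.
    by move: bj; rewrite /negp /posp; do 2!case: ifP; lia.
  rewrite -negb_and; apply/negP => /andP[].
  move=> /prodf_eq0[k kj]; rewrite expf_eq0 => /andP[pk rk].
  move=> /prodf_eq0[k' kj']; rewrite expf_eq0 => /andP[pk' rk'].
  have ki : k != i by apply: contraTneq pk => ->; rewrite bi.
  have ki' : k' != i by apply: contraTneq pk' => ->; rewrite bi.
  have kk : k = k'.
    apply/val_inj/(natr_inj_pchar0 charK).
    rewrite -(cE x 0 k) // -(cE x 0 k') //; apply: (addrI r).
    by rewrite (eqP rk) (eqP rk').
  by move: pk pk'; rewrite kk; case: (posp_negp (beta 0 k')) => ->.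
pose S := \sum_(k | (k != i) && (k != j)) (k : nat)%:R *~ beta 0 k : K.
pose ell : {poly K} := S%:P + (beta 0 j)%:~R *: 'X.
have ell0 : ell != 0.
  apply: contraNneq (intK _ bj) => E.
  have : ell`_1 = 0 by rewrite E coef0.
  by rewrite coefD coefC coefZ coefX add0r mulr1 => ->.
have [|y] := @exists_nonroot K (ell * \prod_(r <- rs) q r).
  by rewrite mulf_neq0 //; apply: prod_neq0.
rewrite hornerM mulf_eq0 negb_or horner_prod => /andP[elly /prod_neq0P hq].
exists (c x y); split; first by rewrite sumA oner_neq0.
- by move: elly; rewrite sumE bi mulr0z add0r hornerD hornerC hornerZ hornerX mulrzl addrC.
move=> s; rewrite pE hrs => /hq; by rewrite qE.
Qed.

Definition injective_at_origin (K : fieldType) (N : nat)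
    (phi : 'rV[K]_2 -> 'rV[K]_N) : Prop :=
  forall z, z != 0 -> same_point (phi z) (phi (pt 1 0)) -> same_point z (pt 1 0).

Lemma chi_scale (K : fieldType) (m : nat) (t : 'I_m -> K) (x : K)
    (v : 'rV[int]_m) : x != 0 ->
  \sum_k v 0 k = 0 -> chi (fun k => x * t k) v = chi t v.
Proof.
move=> x0 v0; rewrite /chi; under eq_bigr do rewrite expfzMl.
rewrite big_split /= -[RHS]mul1r; congr (_ * _).
rewrite -[RHS](expr0z x) -[X in x ^ X]v0; symmetry.
by apply: (big_morph (fun a => x ^ a)) => [a b|]; rewrite ?expfzDr ?expr0z.
Qed.

(** In the coordinate [s = z_0 / z_1], centred so that the base point is at
    infinity, and after rescaling the forms to have the same leading
    coefficient, a second point with the same image is a common zero of two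
    polynomials with generically no common zero. *)
Lemma generic_injective_at_origin (K : closedFieldType)
    (charK : [pchar K] =i pred0) (n l d : nat) (A tau : {fset 'rV[int]_n})
    (pi : 'rV[int]_n -> 'rV[int]_l.+1) u0 u1 u2 (i j : 'I_l.+1) :
  {subset tau <= A} ->
  (forall u, u \in tau -> in_simplex d (pi u)) ->
  (forall k, exists2 u, u \in tau & pi u 0 k != 0) ->
  u0 \in tau -> u1 \in tau -> u2 \in tau ->
  (pi u1 - pi u0) 0 i * (pi u2 - pi u0) 0 j
    - (pi u1 - pi u0) 0 j * (pi u2 - pi u0) 0 i != 0 ->
  generic (fun v : 'rV[K]_(l.+1 * 2) =>
    injective_at_origin (curve_param A tau pi (vec_mx v))).
Proof.
move=> tauA sim sup u0t u1t u2t; set v1 := pi u1 - pi u0; set v2 := pi u2 - pi u0 => D0.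
have sum0 u : u \in tau -> \sum_k (pi u - pi u0) 0 k = 0.
  move=> ut; under eq_bigr do rewrite !mxE.
  by rewrite sumrB; case: (sim _ ut) => _ ->; case: (sim _ u0t) => _ ->; rewrite subrr.
pose alpha := v1 *~ v2 0 j - v2 *~ v1 0 j.
pose beta := v2 *~ v1 0 i - v1 *~ v2 0 i.
have alphaE k : alpha 0 k = v1 0 k * v2 0 j - v2 0 k * v1 0 j.
  by rewrite /alpha -mulrNz mxE !mulrz_mxE mulrN.
have betaE k : beta 0 k = v2 0 k * v1 0 i - v1 0 k * v2 0 i.
  by rewrite /beta -mulrNz mxE !mulrz_mxE mulrN.
have ai : alpha 0 i != 0 by rewrite alphaE [v2 0 i * _]mulrC.
have aj : alpha 0 j = 0 by rewrite alphaE mulrC subrr.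
have bi : beta 0 i = 0 by rewrite betaE mulrC subrr.
have bj : beta 0 j != 0 by rewrite betaE mulrC.
have sa : \sum_k alpha 0 k = 0.
  under eq_bigr do rewrite alphaE.
  by rewrite sumrB -!mulr_suml !sum0 // !mul0r subrr.
have sb : \sum_k beta 0 k = 0.
  under eq_bigr do rewrite betaE.
  by rewrite sumrB -!mulr_suml !sum0 // !mul0r subrr.
have height (v : 'rV[int]_l.+1) k : v 0 k != 0 -> \sum_k v 0 k = 0 -> (0 < char_height v)%N.
  move=> vk /char_heightE hv; rewrite lt0n; apply: contra vk => /eqP h0.
  move: hv; rewrite h0 => /eqP; rewrite sum_nat_eq0 => /forallP/(_ k) /= /eqP nk.
  move/eqP: h0; rewrite sum_nat_eq0 => /forallP/(_ k) /= /eqP pk.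
  by rewrite -(pospBnegp (v 0 k)) pk nk.
have ha := height _ _ ai sa; have hb := height _ _ bj sb.
pose X (k : 'I_l.+1) (q : 'I_2) : {mpoly K[l.+1 * 2]} := 'X_(mxvec_index k q).
have XE (v : 'rV[K]_(l.+1 * 2)) k q : (X k q).@[v 0] = vec_mx v k q.
  by rewrite mevalXU -{1}[v]vec_mxK mxvecE.
(* scaling the [k]-th form by the other coefficients of [z_0] gives all forms
   the same coefficient of [z_0]; [C k] is then the coefficient of [z_1] *)
pose C (k : 'I_l.+1) := X k 1 * \prod_(q | q != k) X q 0.
have CE (v : 'rV[K]_(l.+1 * 2)) k :
    (C k).@[v 0] = vec_mx v k 1 * \prod_(q | q != k) vec_mx v q 0.
  rewrite mevalM XE rmorph_prod; congr (_ * _).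
  by apply: eq_bigr => q _; apply: XE.
have [c [ca cb ccop]] := coprime_parameters charK ai aj bi bj sa ha.
pose w : 'rV[K]_(l.+1 * 2) := mxvec (\matrix_(k, q) (if q == 0 then 1 else c k)).
have Cw k : (C k).@[w 0] = c k.
  by rewrite CE mxvecK mxE /= big1 ?mulr1 // => q _; rewrite mxE.
have specE (v : 'rV[K]_(l.+1 * 2)) e :
    map_poly (meval (v 0)) (character_eqn C e) = character_eqn (fun k => (C k).@[v 0]) e.
  exact: map_character_eqn.
have specw e : map_poly (meval (w 0)) (character_eqn C e) = character_eqn c e.
  rewrite specE /character_eqn /root_poly; congr (_ - _);
    by apply: eq_bigr => k _; rewrite Cw.
have lead (e : 'rV[int]_l.+1) : \sum_k e 0 k = 0 -> (0 < char_height e)%N ->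
    \sum_k c k *~ e 0 k != 0 -> (lead_coef (character_eqn C e)).@[w 0] != 0.
  move=> se he ce; have [sz _] := character_eqn_top C se he.
  apply: lead_coef_map_neq0 sz _; rewrite -coef_map specw.
  by have [_ ->] := character_eqn_top c se he.
have G1 := @generic_no_common_root K _ (character_eqn C alpha) (character_eqn C beta) w.
rewrite /= !specw in G1; have {}G1 := G1 (lead _ sa ha ca) (lead _ sb hb cb) ccop.
have G2 : generic (fun v : 'rV[K]_(l.+1 * 2) => (\prod_k X k 0).@[v 0] != 0).
  apply: (@generic_value _ _ _ w); rewrite rmorph_prod; apply/prodf_neq0 => k _ /=.
  by rewrite XE mxvecK mxE oner_neq0.
apply: generic_imp (generic_and G1 G2) => v [cop].
rewrite rmorph_prod /= => av; set f := vec_mx v.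
have aE k : (X k 0).@[v 0] = lform f k (pt 1 0).
  by rewrite XE /lform pt0 pt1 mulr1 mulr0 addr0.
have a0 k : lform f k (pt 1 0) != 0.
  by rewrite -aE; apply: (prodf_neq0 _ _ av).
move=> z z0 /(same_image_chi tauA sim sup a0); set t := fun k => _ => -[t0 ht].
have [z10|z10] := eqVneq (z 0 1) 0.
  exists (z 0 0); first by move: z0; rewrite [z]ptE pt_neq0 z10 eqxx orbF mxE.
  by apply/rowP => q; rewrite [z in LHS]ptE z10 !mxE; case: ifP; rewrite ?mulr1 ?mulr0.
pose a := \prod_k lform f k (pt 1 0).
have an0 : a != 0 by apply/prodf_neq0.
pose s := a * z 0 0 / z 0 1.
have key k : s + (C k).@[v 0] = a / z 0 1 * t k.
  have -> : (C k).@[v 0] = f k 1 * (a / lform f k (pt 1 0)).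
    rewrite CE -/f /a [in RHS](bigD1 k) //= [lform _ _ _ * _]mulrC mulfK //; congr (_ * _).
    by apply: eq_bigr => q _; rewrite -aE XE.
  have -> : t k = (f k 0 * z 0 0 + f k 1 * z 0 1) / lform f k (pt 1 0) by [].
  have Ek : f k 0 = lform f k (pt 1 0) by rewrite -aE XE.
  by rewrite Ek /s; field; rewrite a0 z10.
have mu0 : a / z 0 1 != 0 by rewrite mulf_neq0 ?invr_eq0.
have chi1 (x y : 'rV[int]_l.+1) (b e : int) :
    chi t x = 1 -> chi t y = 1 -> chi t (x *~ b - y *~ e) = 1.
  by move=> hx hy; rewrite chiD // chiN // !chiMz // invr1 mulr1.
have rt (e : 'rV[int]_l.+1) : \sum_k e 0 k = 0 -> chi t e = 1 ->
    root (map_poly (meval (v 0)) (character_eqn C e)) s.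
  move=> se ce; rewrite specE; apply: root_character_eqn.
    by move=> k; rewrite key mulf_neq0.
  rewrite -ce -(chi_scale t mu0 se); apply: eq_bigr => k _.
  by rewrite key.
have := cop s (rt _ sa (chi1 _ _ _ _ (ht _ _ u1t u0t) (ht _ _ u2t u0t))).
by rewrite (rt _ sb (chi1 _ _ _ _ (ht _ _ u2t u0t) (ht _ _ u1t u0t))).
Qed.

Lemma mpoly_on_line (K : fieldType) (N : nat) (G : {mpoly K[N]}) (v w : 'rV[K]_N) :
  exists g : {poly K}, forall t, g.[t] = G.@[(v + t *: w) 0].
Proof.
exists (mmap polyC (fun k => (v 0 k)%:P + w 0 k *: 'X) G) => t.
rewrite mevalE /mmap horner_sum; apply: eq_bigr => m _.
rewrite hornerM hornerC horner_prod; congr (_ * _); apply: eq_bigr => k _.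
by rewrite horner_exp hornerD hornerC hornerZ hornerX !mxE mulrC.
Qed.

(** A shear moves [1 : 0] to any affine point [1 : t] and acts on the forms, so
    for fixed general forms the condition at the origin holds after all but
    finitely many of these shears. *)
Lemma injective_from_origin (K : fieldType) (n l : nat)
    (A tau : {fset 'rV[int]_n}) (pi : 'rV[int]_n -> 'rV[int]_l.+1) :
  generic (fun v : 'rV[K]_(l.+1 * 2) =>
    injective_at_origin (curve_param A tau pi (vec_mx v))) ->
  generic (fun v : 'rV[K]_(l.+1 * 2) =>
    generically_injective (curve_param A tau pi (vec_mx v))).
Proof.
move=> [G G0 hG]; exists G => // v Gv; set f := vec_mx v.
pose w : 'rV[K]_(l.+1 * 2) := mxvec (\matrix_(k, q) (if q == 0 then f k 1 else 0)).
have [g gE] := mpoly_on_line G v w.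
exists g; first by apply: contraNneq Gv => g0; rewrite -[v]addr0 -(scale0r w) -gE g0 horner0.
move=> t z; rewrite gE => /hG inj z0; set h := vec_mx _ in inj.
have hE y : curve_param A tau pi h y = curve_param A tau pi f (pt (y 0 0) (y 0 1 + t * y 0 0)).
  apply/rowP => k; rewrite /curve_param [LHS]mxE [RHS]mxE /=; case: (_ \in tau) => //.
  apply: eq_bigr => q _; congr (_ ^+ _).
  rewrite /lform /h !linearD !linearZ /= mxvecK !mxE /= -/f; ring.
pose z' := pt (z 0 0) (z 0 1 - t * z 0 0).
have z'E : curve_param A tau pi h z' = curve_param A tau pi f z.
  by rewrite hE pt0 pt1 subrK -ptE.
have oE : curve_param A tau pi h (pt 1 0) = curve_param A tau pi f (pt 1 t).
  by rewrite hE pt0 pt1 mulr1 add0r.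
rewrite -z'E -oE => /inj; case.
  move: z0; rewrite [z in z != 0]ptE !pt_neq0; case: (eqVneq (z 0 0) 0) => //= ->.
  by rewrite mulr0 subr0.
move=> c c0 /rowP E; exists c => //.
have := E 0; have := E 1; rewrite !mxE /= mulr1 mulr0 => /eqP; rewrite subr_eq0 => /eqP E1 E0.
by apply/rowP => q; rewrite [z]ptE !mxE; case: ifP; rewrite ?E1 ?E0 ?mulr1 // mulrC.
Qed.

(** * Primitive Cayley structures *)

Lemma generic_distinct_roots (K : fieldType) (m : nat) :
  generic (fun v : 'rV[K]_(m * 2) => distinct_roots (vec_mx v)).
Proof.
pose X (k : 'I_m) (q : 'I_2) : {mpoly K[m * 2]} := 'X_(mxvec_index k q).
have XE (v : 'rV[K]_(m * 2)) k q : (X k q).@[v 0] = vec_mx v k q.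
  by rewrite mevalXU -{1}[v]vec_mxK mxvecE.
pose minor (ij : 'I_m * 'I_m) := X ij.1 0 * X ij.2 1 - X ij.1 1 * X ij.2 0.
have minorE (v : 'rV[K]_(m * 2)) ij : (minor ij).@[v 0] =
    vec_mx v ij.1 0 * vec_mx v ij.2 1 - vec_mx v ij.1 1 * vec_mx v ij.2 0.
  by rewrite mevalB !mevalM !XE.
apply: (@generic_imp _ _ (fun v => forall ij, ij \in enum [pred ij : 'I_m * 'I_m | ij.1 != ij.2] ->
    (minor ij).@[v 0] != 0)).
  move=> v h i j ij y y0 fi; apply/eqP => fj.
  have := h (i, j); rewrite mem_enum inE minorE /= => /(_ ij) nz.
  move: fi fj y0; rewrite /lform [y]ptE !pt0 !pt1 pt_neq0 => fi fj; apply/negP.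
  move: nz; set a := vec_mx v i 0 in fi *; set b := vec_mx v i 1 in fi *.
  set c := vec_mx v j 0 in fj *; set e := vec_mx v j 1 in fj *.
  move: (y 0 0) (y 0 1) fi fj => s t fi fj nz.
  rewrite negb_or !negbK; apply/andP; split; rewrite -(mulIr_eq0 _ (mulIf nz)).
    have -> : s * (a * e - b * c) = (a * s + b * t) * e - (c * s + e * t) * b by ring.
    by rewrite fi fj !mul0r subrr.
  have -> : t * (a * e - b * c) = (c * s + e * t) * a - (a * s + b * t) * c by ring.
  by rewrite fi fj !mul0r subrr.
apply: generic_all => -[i j]; rewrite mem_enum inE /= => ij.
pose w : 'rV[K]_(m * 2) := mxvec (\matrix_(k, q) (((k == i) == (q == 0))%:R)).
apply: (@generic_value _ _ _ w); rewrite minorE /= mxvecK !mxE !eqxx /=.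
by rewrite [j == i]eq_sym (negPf ij) /= mulr1 mulr0 subr0 oner_neq0.
Qed.

Lemma generic_nonzero_forms (K : fieldType) (m : nat) :
  generic (fun v : 'rV[K]_(m * 2) => nonzero_forms (vec_mx v)).
Proof.
apply: (@generic_imp _ _ (fun v : 'rV[K]_(m * 2) => forall k, k \in enum 'I_m -> vec_mx v k 0 != 0)).
  move=> v h k; have := h k; rewrite mem_enum => /(_ isT).
  by apply: contraNneq => /rowP/(_ 0); rewrite !mxE => ->.
apply: generic_all => k _.
pose X : {mpoly K[m * 2]} := 'X_(mxvec_index k 0).
have E (v : 'rV[K]_(m * 2)) : X.@[v 0] = vec_mx v k 0.
  by rewrite mevalXU -{1}[v]vec_mxK mxvecE.
apply: (@generic_imp _ _ (fun v : 'rV[K]_(m * 2) => X.@[v 0] != 0)).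
  by move=> v; rewrite E.
by apply: (@generic_value _ _ _ (mxvec (const_mx 1))); rewrite E mxvecK mxE oner_neq0.
Qed.

(** If all these minors vanish, every difference of image points is a multiple
    of [pi u1 - pi u0]. *)
Lemma lattice_dim_minor (n l : nat) (tau : {fset 'rV[int]_n})
    (pi : 'rV[int]_n -> 'rV[int]_l.+1) u0 u1 :
  u0 \in tau -> u1 \in tau -> pi u0 != pi u1 ->
  lattice_dim (img tau pi) <> 1%N ->
  exists u2 (i j : 'I_l.+1), u2 \in tau /\
    (pi u1 - pi u0) 0 i * (pi u2 - pi u0) 0 j
      - (pi u1 - pi u0) 0 j * (pi u2 - pi u0) 0 i != 0.
Proof.
move=> u0t u1t n01 dim1; set e := pi u1 - pi u0.
have [/hasP[u2 u2t /existsP[i /existsP[j hij]]]|/hasPn h] :=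
  boolP (has (fun u => [exists i, exists j,
    e 0 i * (pi u - pi u0) 0 j - e 0 j * (pi u - pi u0) 0 i != 0]) tau).
  by exists u2, i, j.
have flat u i j : u \in tau -> e 0 i * (pi u - pi u0) 0 j = e 0 j * (pi u - pi u0) 0 i.
  move=> /h /existsPn/(_ i)/existsPn/(_ j); rewrite negbK subr_eq0 => /eqP.
  exact.
case: dim1; rewrite /lattice_dim; set B := img tau pi; set X := [seq _ | _ <- B, _ <- B].
have [i ei] : exists i, e 0 i != 0.
  apply/existsP; apply: contraNT n01 => /existsPn h0; apply/eqP/rowP => i.
  by have := h0 i; rewrite negbK !mxE subr_eq0 => /eqP.
have e0 : toQ e != 0.
  by apply: contraNneq ei => /rowP/(_ i); rewrite !mxE => /eqP; rewrite intr_eq0.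
have toQB a b : toQ (a - b) = toQ a - toQ b :> 'rV[rat]_l.+1.
  by apply/rowP => k; rewrite !mxE rmorphB.
have on_e u : u \in tau -> toQ (pi u - pi u0) \in <[toQ e]>%VS.
  move=> ut; apply/vlineP; exists (((pi u - pi u0) 0 i)%:~R / (e 0 i)%:~R).
  apply/rowP => k; rewrite [RHS]mxE ![toQ _ 0 _]mxE mulrAC -intrM.
  rewrite [_ * e 0 k]mulrC -(flat u i k ut) intrM mulrC mulKf //.
  by rewrite intr_eq0.
have sub : (<<X>> <= <[toQ e]>)%VS.
  apply/span_subvP => x /allpairsP[[a b] /= [/imfsetP[u /= ut ->] /imfsetP[v /= vt ->] ->]].
  have -> : pi u - pi v = (pi u - pi u0) - (pi v - pi u0) by rewrite opprB addrA subrK.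
  by rewrite toQB rpredB ?on_e.
apply/eqP; rewrite eqn_leq; apply/andP; split.
  by apply: leq_trans (dimvS sub) _; rewrite dim_vline e0.
rewrite lt0n dimv_eq0; apply: contraNneq e0 => X0.
rewrite -memv0 -X0; apply: memv_span.
by apply: (allpairs_f (fun u v => toQ (u - v))); apply: in_imfset.
Qed.

Section Cayley.

Variables (n l d : nat) (tau : {fset 'rV[int]_n}).
Variable pi : 'rV[int]_n -> 'rV[int]_l.+1.
Hypothesis cay : cayley d tau pi.

Lemma cayley_vanish i : exists2 u, u \in tau & pi u 0 i = 0.
Proof. by case: cay => _ _ _ /(_ i)[[w /imfsetP[u /= ut ->] h] _]; exists u. Qed.

Lemma cayley_support i : exists2 u, u \in tau & pi u 0 i != 0.
Proof. by case: cay => _ _ _ /(_ i)[_ [w /imfsetP[u /= ut ->] h]]; exists u. Qed.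

Lemma cayley_degree_gt0 : (0 < d)%N.
Proof.
case: cay => sim _ _ _; have [u ut /negPf h] := cayley_support ord0.
rewrite lt0n; apply: contraFneq h => d0; have /simplex_absz := sim u ut.
by rewrite d0 => /eqP; rewrite sum_nat_eq0 => /forallP/(_ ord0) /=; rewrite absz_eq0.
Qed.

End Cayley.

(** A common divisor of the differences of the second coordinate divides the
    whole difference lattice, the coordinate sum being constant. *)
Lemma primitive_length_one (n d : nat) (tau : {fset 'rV[int]_n})
    (pi : 'rV[int]_n -> 'rV[int]_2) (m : nat) :
  cayley d tau pi -> primitive tau pi ->
  (forall u v, u \in tau -> v \in tau -> (m%:Z %| (pi u - pi v) ord0 1%R)%Z) ->
  m = 1%N.
Proof.
move=> [sim _ [u [v [ut vt nuv]]] _] prim hm.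
have sum0 x : x \in tau -> pi x 0 0 = d%:Z - pi x 0 1.
  move=> /sim[_]; rewrite !big_ord_recl big_ord0 addr0 => <-.
  rewrite (_ : lift ord0 ord0 = 1); last exact/val_inj.
  by rewrite addrK.
have two (i : 'I_2) : i = 0 \/ i = 1.
  by case: i => [[|[|]]] // ?; [left | right]; apply/val_inj.
have diff0 x y : x \in tau -> y \in tau -> (pi x - pi y) 0 0 = - (pi x - pi y) 0 1.
  by move=> xt yt; rewrite !mxE !sum0 //; ring.
case: m hm => [|[|m]] // hm.
  case/eqP: nuv; apply/rowP => i.
  have E1 : (pi u - pi v) 0 1 = 0 by apply/eqP; rewrite -dvd0z; apply: hm.
  apply/eqP; rewrite -subr_eq0; have -> : pi u 0 i - pi v 0 i = (pi u - pi v) 0 i by rewrite !mxE.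
  by case: (two i) => ->; rewrite ?diff0 // E1 ?oppr0.
case: prim; right; split=> //; exists m.+2 => // w [c ->] i.
rewrite summxE big_seq; apply: rpred_sum => x /imfsetP[x' /= xt ->].
rewrite summxE big_seq; apply: rpred_sum => y /imfsetP[y' /= yt ->].
rewrite mulrz_mxE dvdz_mulr //.
by case: (two i) => ->; rewrite ?diff0 // ?rpredN; apply: hm.
Qed.

(** A primitive structure of length at least two has an image of dimension at
    least two, and one of length one has differences with greatest common
    divisor one; either way the parametrization is generically injective. *)
Theorem primitive_degree (K : closedFieldType) (charK : [pchar K] =i pred0)
    (n l d : nat) (A tau : {fset 'rV[int]_n})
    (pi : 'rV[int]_n -> 'rV[int]_l.+1) :
  {subset tau <= A} -> cayley d tau pi -> primitive tau pi ->
  general_forms (fun f : 'M[K]_(l.+1, 2) => curve_degree (curve A tau pi f) d).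
Proof.
move=> tauA cay prim.
have van := cayley_vanish cay; have sup := cayley_support cay.
have d0 := cayley_degree_gt0 cay.
have [sim _ [u0 [u1 [u0t u1t n01]]] _] := cay.
suff : generic (fun v : 'rV[K]_(l.+1 * 2) => nonzero_forms (vec_mx v) ->
    distinct_roots (vec_mx v) ->
    generically_injective (curve_param A tau pi (vec_mx v))).
  move=> /(generic_and (generic_distinct_roots K l.+1)); apply: generic_imp => v [df inj] /= nz.
  by apply: cayley_curve_degree => //; apply: inj.
case: l pi cay prim van sup sim n01 => [|[|l]] pi' cay prim van sup sim n01.
- case/eqP: n01; apply/rowP => i; rewrite ord1.
  have s1 u : u \in tau -> pi' u 0 0 = d%:Z by move=> /sim[_]; rewrite big_ord1.
  by rewrite !s1.
- exists 1; rewrite ?oner_neq0 // => v _ nz df.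
  apply: (length_one_injective tauA sim sup _ nz df) => m; exact: primitive_length_one cay prim.
have [|u2 [i [j [u2t hij]]]] := lattice_dim_minor u0t u1t n01.
  by move=> dim1; apply: prim; left.
have := generic_injective_at_origin charK tauA sim sup u0t u1t u2t hij.
by move=> /injective_from_origin; apply: generic_imp.
Qed.

(** * Imprimitive Cayley structures *)

(** Let [g] generate the difference lattice. An affine map taking the endpoints
    [p] and [q = p + d' g] to [(d', 0)] and [(0, d')] sends [p + k g] to
    [(d' - k, k)]. A coordinate is nonnegative on the image and vanishes at some
    but not all of its points, so it vanishes at exactly one endpoint: [p] and
    [q] are [d'] times the negative and the positive part of [g]. *)
Lemma reduction_coordinates (n l d d' : nat) (tau : {fset 'rV[int]_n})
    (pi : 'rV[int]_n -> 'rV[int]_l.+1) (pi' : 'rV[int]_n -> 'rV[int]_2) :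
  cayley d tau pi -> is_reduction tau pi d' pi' ->
  exists g : 'rV[int]_l.+1,
    [/\ diff_lattice (img tau pi) g,
        [/\ (0 < d')%N, forall i, g 0 i != 0 & \sum_i g 0 i = 0],
        exists2 u, u \in tau & pi' u = pt d'%:Z 0,
        exists2 u, u \in tau & pi' u = pt 0 d'%:Z
      & forall u, u \in tau -> exists2 k : nat, (k <= d')%N &
          pi' u = pt (d' - k)%N%:Z k%:Z /\
          forall i, absz (pi u 0 i) =
            (negp (g 0%R i) * (d' - k) + posp (g 0%R i) * k)%N].
Proof.
move=> cay [p [q [rho [[pB qB cv [g [hg qp]]] [aff injr simr] rp rq pirho]]]].
have [sim _ [a [b [at_ bt nab]]] _] := cay.
have gB : diff_lattice (img tau pi) g by apply/hg; exists 1.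
have diffB u v : u \in img tau pi -> v \in img tau pi -> exists k : int, u - v = g *~ k.
  move=> uB vB; apply/hg; exists (fun x y => if (x == u) && (y == v) then 1 else 0).
  rewrite (bigD1_seq u) ?fset_uniq //= (bigD1_seq v) ?fset_uniq //= !eqxx mulr1z.
  rewrite big1 => [|y /negPf->]; last by rewrite mulr0z.
  by rewrite addr0 big1 ?addr0 // => x /negPf xu; rewrite big1 // => y _; rewrite xu mulr0z.
have aB : pi a \in img tau pi by apply: in_imfset.
have bB : pi b \in img tau pi by apply: in_imfset.
have g0 : g != 0.
  apply: contraNneq nab => g0; rewrite -subr_eq0.
  by have [k ->] := diffB _ _ aB bB; rewrite g0 mul0rz.
have d'0 : (0 < d')%N.
  rewrite lt0n; apply: contraNneq nab => d0; apply/eqP.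
  have r0 w : w \in img tau pi -> rho w = 0.
    move=> /simr[w0]; rewrite d0 => /eqP; rewrite psumr_eq0 => [/allP h|i _]; last exact: w0.
    apply/rowP => i; rewrite mxE; apply/eqP.
    by have := h i (mem_index_enum _).
  by apply: injr => //; rewrite !r0.
have [L [c hL]] := aff.
have coord w : w \in img tau pi -> exists2 k : nat, (k <= d')%N &
    rho w = pt (d' - k)%N%:Z k%:Z /\ w = p + g *+ k.
  move=> wB; have [k Ek] := diffB _ _ wB pB.
  have wE : w = p + g *~ k by rewrite -Ek addrC subrK.
  have toQD x y (z : int) : toQ (x + y *~ z) = toQ x + z%:~R *: toQ y :> 'rV[rat]_l.+1.
    by apply/rowP => i; rewrite !mxE mulrz_mxE intrD intrM mulrC.
  have rE (j : 'I_2) (z : int) x : x \in img tau pi -> x = p + g *~ z ->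
      ((rho x 0 j)%:~R : rat) = (rho p 0 j)%:~R + z%:~R * (toQ g *m L) 0 j.
    move=> xB E; have := hL x xB.
    rewrite [in RHS]E toQD mulmxDl -scalemxAl addrAC -(hL p pB) => /rowP/(_ j).
    by rewrite [toQ _ 0 _]mxE => ->; rewrite !mxE.
  have qE : q = p + g *~ d'%:Z by rewrite -pmulrn -qp addrC subrK.
  have rwj j : (rho w 0 j - rho p 0 j) * d'%:Z = k * (rho q 0 j - rho p 0 j).
    apply: (@intr_inj rat); rewrite !intrM !intrB (rE j _ w wB wE) (rE j _ q qB qE).
    by ring.
  have r1 : rho w 0 1 = k.
    have := rwj 1; rewrite rp rq !mxE /= mulr0 subr0 mulr1 subr0 => /mulIf; apply.
    by rewrite eqz_nat -lt0n.
  have r0 : rho w 0 0 = d'%:Z - k.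
    have := rwj 0; rewrite rp rq !mxE /= mulr0 mulr1 sub0r mulrN -mulNr => /mulIf h.
    by have := h _; rewrite eqz_nat -lt0n d'0 => /(_ isT) <-; rewrite addrC subrK.
  have [ge0 _] := simr w wB.
  have k0 : 0 <= k by rewrite -r1.
  have kd : 0 <= d'%:Z - k by rewrite -r0.
  case: k k0 kd r0 r1 wE {Ek rwj} => // k _ kd r0 r1 wE.
  have kd' : (k <= d')%N by rewrite -lez_nat -subr_ge0.
  exists k => //; split; last by rewrite wE -pmulrn.
  by rewrite [LHS]ptE r0 r1 subzn.
have simB w : w \in img tau pi -> in_simplex d w.
  by move=> /imfsetP[u /= ut ->]; apply: sim.
have sg : \sum_i g 0 i = 0.
  have [_ sq] := simB q qB; have [_ sp] := simB p pB.
  have : \sum_i (q - p) 0 i = 0.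
    by under eq_bigr do rewrite !mxE; rewrite sumrB sq sp subrr.
  rewrite qp; under eq_bigr => i _ do rewrite pmulrn mulrz_mxE.
  by rewrite -mulr_suml => /eqP; rewrite mulf_eq0 eqz_nat (gtn_eqF d'0) orbF => /eqP.
have gE i (k : nat) : (g *+ k) 0 i = g 0 i * k%:Z by rewrite pmulrn mulrz_mxE.
have pq i : q 0 i = p 0 i + g 0 i * d'%:Z.
  by rewrite -gE -qp !mxE; ring.
have p0 i : 0 <= p 0 i by have [] := simB p pB.
have q0 i : 0 <= q 0 i by have [] := simB q qB.
have ends i : (p 0 i = 0 /\ 0 < g 0 i) \/ (q 0 i = 0 /\ g 0 i < 0).
  have [u ut u0] := cayley_vanish cay i; have [v vt v0] := cayley_support cay i.
  have uB : pi u \in img tau pi by apply: in_imfset.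
  have vB : pi v \in img tau pi by apply: in_imfset.
  have [k kd [_ Eu]] := coord _ uB; have [k' kd' [_ Ev]] := coord _ vB.
  have Eu' : pi u 0 i = p 0 i + g 0 i * k%:Z by rewrite Eu mxE gE.
  have Ev' : pi v 0 i = p 0 i + g 0 i * k'%:Z by rewrite Ev mxE gE.
  have v0' : 0 <= pi v 0 i by have [] := simB _ vB.
  move: u0 v0 v0' (p0 i) (q0 i) d'0 kd kd'; rewrite Eu' Ev' pq.
  by clear; move: (p 0 i) (g 0 i) => x y; nia.
exists g; split=> //.
- by split=> // i; case: (ends i) => -[_]; lia.
- have [u /= ut pE] := imfsetP _ _ _ _ pB; exists u => //.
  by rewrite pirho // -pE rp; apply/rowP => j; rewrite !mxE; case: (j == 0); rewrite ?mulr1 ?mulr0.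
- have [u /= ut qE] := imfsetP _ _ _ _ qB; exists u => //.
  rewrite pirho // -qE rq; apply/rowP => j; rewrite !mxE.
  by case: j => [[|[|]]] //= ?; rewrite ?mulr1 ?mulr0.
move=> u ut; have uB : pi u \in img tau pi by apply: in_imfset.
have [k kd [rE uE]] := coord _ uB; exists k => //; split; first by rewrite pirho.
move=> i; have Eu : pi u 0 i = p 0 i + g 0 i * k%:Z by rewrite {1}uE mxE gE.
have := ends i; have := pq i; rewrite Eu /negp /posp.
move: (p 0 i) (q 0 i) (g 0 i) kd; clear => x y z kd -> [] [h1 h2].
  by rewrite (ltW h2) oppr_ge0 leNgt h2 /= h1; nia.
rewrite oppr_ge0 (ltW h2) [0 <= z]leNgt h2 /=.
have -> : x + z * k%:Z = - z * (d' - k)%N%:Z by rewrite -subzn //; nia.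
by nia.
Qed.

Lemma binary_form_zero (K : closedFieldType) (e : nat) (p : {poly K}) :
  (0 < e)%N -> (size p <= e.+1)%N -> exists2 y : 'rV[K]_2, y != 0 & hform e p y = 0.
Proof.
move=> e0 sp; have [pe|pe] := eqVneq p`_e 0.
  by exists (pt 0 1); rewrite ?hform_infty // pt_neq0 oner_eq0 orbT.
have /closed_rootP[t /rootP pt0] : size p != 1%N.
  by apply: contraNneq pe => sp1; rewrite nth_default // sp1.
by exists (pt 1 t); rewrite ?hform_affine // pt_neq0 oner_eq0.
Qed.

Lemma exists_nth_root (K : closedFieldType) (e : nat) (c : K) :
  (0 < e)%N -> exists s, s ^+ e = c.
Proof.
move=> e0; have [|s] := @closed_rootP K ('X^e - c%:P) _.
  by rewrite size_XnsubC // eqSS -lt0n.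
by rewrite rootE !hornerE subr_eq0 => /eqP E; exists s.
Qed.

(** At a zero [y] of [x_1 p - x_0 q] the vector [(p, q)] is a multiple of [x],
    nonzero by coprimality; rescaling [y] by an [e]-th root corrects the
    factor. *)
Lemma coprime_forms_onto (K : closedFieldType) (e : nat) (p q : {poly K}) (x : 'rV[K]_2) :
  (0 < e)%N -> (size p <= e.+1)%N -> (size q <= e.+1)%N ->
  (forall y, y != 0 -> hform e p y = 0 -> hform e q y != 0) -> x != 0 ->
  exists2 y, y != 0 & pt (hform e p y) (hform e q y) = x.
Proof.
move=> e0 sp sq cop x0; pose r := x 0 1 *: p - x 0 0 *: q.
have rE y : hform e r y = x 0 1 * hform e p y - x 0 0 * hform e q y.
  rewrite /hform !mulr_sumr -sumrB; apply: eq_bigr => i _.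
  by rewrite coefB !coefZ; ring.
have [|y y0] := @binary_form_zero K e r e0.
  apply: leq_trans (size_polyD _ _) _; rewrite size_polyN geq_max.
  by rewrite !(leq_trans (size_scale_leq _ _)).
rewrite rE => /eqP; rewrite subr_eq0 => /eqP E.
have [c c0 [Ep Eq]] : exists2 c, c != 0 &
    hform e p y = c * x 0 0 /\ hform e q y = c * x 0 1.
  have [z|z] := eqVneq (x 0 0) 0.
    have x1 : x 0 1 != 0 by move: x0; rewrite [x in x != 0]ptE pt_neq0 z eqxx.
    have p0 : hform e p y = 0.
      by apply: (mulfI x1); rewrite E z mul0r mulr0.
    exists (hform e q y / x 0 1); last by rewrite z mulr0 divfK.
    by rewrite mulf_neq0 ?invr_eq0 // cop.
  exists (hform e p y / x 0 0); last first.
    by rewrite divfK // mulrAC -[_ * x 0 1]mulrC E mulrC mulKf.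
  rewrite mulf_neq0 ?invr_eq0 //; apply/eqP => p0.
  have := cop y y0 p0; move/eqP: E; rewrite p0 mulr0 eq_sym mulf_eq0 (negPf z) /=.
  by move=> ->.
have [s hs] := @exists_nth_root K e c^-1 e0.
have s0 : s != 0.
  by apply: contraNneq c0 => s0; rewrite -invr_eq0 -hs s0 expr0n (gtn_eqF e0).
exists (s *: y); first by rewrite scaler_eq0 negb_or s0.
by rewrite !hformZ hs Ep Eq !mulKf // -ptE.
Qed.

Lemma distinct_roots_onto (K : fieldType) (f : 'M[K]_(2, 2)) (x : 'rV[K]_2) :
  nonzero_forms f -> distinct_roots f ->
  exists z, lform f 0 z = x 0 0 /\ lform f 1 z = x 0 1.
Proof.
move=> nz df; pose D := f 0 0 * f 1 1 - f 0 1 * f 1 0.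
have D0 : D != 0.
  apply/eqP => D0; have y0 : pt (f 0 1) (- f 0 0) != 0.
    have := nz 0; rewrite [row 0 f]ptE !mxE !pt_neq0 oppr_eq0 orbC; exact.
  have := df 0 1 isT _ y0; rewrite /lform !pt0 !pt1.
  have -> : f 0 0 * f 0 1 + f 0 1 * - f 0 0 = 0 by ring.
  have -> : f 1 0 * f 0 1 + f 1 1 * - f 0 0 = - D by rewrite /D; ring.
  by rewrite D0 oppr0 eqxx => /(_ erefl).
exists (pt ((x 0 0 * f 1 1 - f 0 1 * x 0 1) / D) ((f 0 0 * x 0 1 - x 0 0 * f 1 0) / D)).
by rewrite /lform !pt0 !pt1; split; rewrite /D in D0 *; field.
Qed.

Lemma lform_pt_neq0 (K : fieldType) (f : 'M[K]_(2, 2)) (z : 'rV[K]_2) :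
  distinct_roots f -> z != 0 -> pt (lform f 0 z) (lform f 1 z) != 0.
Proof.
move=> df z0; rewrite pt_neq0; case: (eqVneq (lform f 0 z) 0) => // f0.
by rewrite (df 0 1 isT z z0 f0).
Qed.

Section Imprimitive.

Variables (K : closedFieldType) (n l d d' : nat) (A tau : {fset 'rV[int]_n}).
Variables (pi : 'rV[int]_n -> 'rV[int]_l.+1) (pi' : 'rV[int]_n -> 'rV[int]_2).
Variable g : 'rV[int]_l.+1.
Hypothesis g0 : forall i, g 0 i != 0.
Hypothesis sg : \sum_i g 0 i = 0.
Hypothesis piE : forall u, u \in tau -> exists2 k : nat, (k <= d')%N &
  pi' u = pt (d' - k)%N%:Z k%:Z /\
  forall i, absz (pi u 0 i) = (negp (g 0%R i) * (d' - k) + posp (g 0%R i) * k)%N.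

Lemma height_gt0 : (0 < char_height g)%N.
Proof.
rewrite lt0n; apply: contraNneq (g0 ord0) => h0.
have hn := char_heightE sg; rewrite h0 in hn.
move/eqP: hn; rewrite sum_nat_eq0 => /forallP/(_ ord0) /= /eqP nk.
move/eqP: h0; rewrite sum_nat_eq0 => /forallP/(_ ord0) /= /eqP pk.
by rewrite -(pospBnegp (g 0 ord0)) pk nk.
Qed.

(** The two products of linear forms through which the parametrization
    factors. *)
Let P (f : 'M[K]_(l.+1, 2)) := \prod_i form_poly f i ^+ negp (g 0 i).
Let Q (f : 'M[K]_(l.+1, 2)) := \prod_i form_poly f i ^+ posp (g 0 i).
Let e := char_height g.

Lemma factorE (f : 'M[K]_(l.+1, 2)) y :
  [/\ (size (P f) <= e.+1)%N, (size (Q f) <= e.+1)%N,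
      hform e (P f) y = \prod_i lform f i y ^+ negp (g 0 i)
    & hform e (Q f) y = \prod_i lform f i y ^+ posp (g 0 i)].
Proof.
have [s1 h1] := hform_prod f (fun i => negp (g 0 i)) y.
have [s2 h2] := hform_prod f (fun i => posp (g 0 i)) y.
by rewrite (char_heightE sg) -/e in s1 h1.
Qed.

Lemma factor_coprime (f : 'M[K]_(l.+1, 2)) y : distinct_roots f ->
  y != 0 -> hform e (P f) y = 0 -> hform e (Q f) y != 0.
Proof.
move=> df y0; have [_ _ -> ->] := factorE f y.
move/eqP/prodf_eq0 => [i _]; rewrite expf_eq0 => /andP[ni /eqP fi].
apply/prodf_neq0 => j _; have [<-|ij] := eqVneq i j.
  by move: ni; case: (posp_negp (g 0 i)) => -> //; rewrite expr0 oner_neq0.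
by rewrite expf_neq0 // (df i j).
Qed.

Lemma curve_param_factor (f : 'M[K]_(l.+1, 2)) (f' : 'M[K]_(2, 2)) y z :
  lform f' 0 z = hform e (P f) y -> lform f' 1 z = hform e (Q f) y ->
  curve_param A tau pi f y = curve_param A tau pi' f' z.
Proof.
move=> E0 E1; apply/rowP => k; rewrite /curve_param [LHS]mxE [RHS]mxE /=.
set u := nth _ _ _; case: (boolP (u \in tau)) => // /piE[j jd [-> hpi]].
rewrite [RHS]big_ord_recl [X in _ = _ * X]big_ord_recl big_ord0 mulr1.
rewrite (_ : lift ord0 ord0 = 1); last exact/val_inj.
rewrite pt0 pt1 !absz_nat E0 E1; have [_ _ -> ->] := factorE f y.
rewrite -!prodrXl -big_split /=; apply: eq_bigr => i _.
by rewrite hpi exprD !exprM.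
Qed.

(** The parametrization is that of the reduction composed with [y |-> (P, Q)],
    which is onto; so both have the same image. *)
Lemma imprimitive_curve (f : 'M[K]_(l.+1, 2)) (f' : 'M[K]_(2, 2)) x :
  distinct_roots f -> nonzero_forms f' -> distinct_roots f' ->
  curve A tau pi f x <-> curve A tau pi' f' x.
Proof.
move=> df nz' df'; apply: zariski_closure_ext => w.
split=> -[w0 [y y0 wE]]; split=> //.
  have [z [E0 E1]] := distinct_roots_onto (pt (hform e (P f) y) (hform e (Q f) y)) nz' df'.
  rewrite pt0 pt1 in E0 E1.
  exists z; last by rewrite wE; apply: curve_param_factor.
  apply/eqP => z0; have := factor_coprime df y0.
  by rewrite -E0 -E1 z0 /lform !mxE !mulr0 addr0 eqxx => /(_ erefl).
have [s1 s2 _ _] := factorE f y.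
have [z z0 Ez] := coprime_forms_onto height_gt0 s1 s2
  (fun y => @factor_coprime f y df) (lform_pt_neq0 df' y0).
exists z => //; rewrite wE; symmetry; apply: curve_param_factor.
  by have /rowP/(_ 0) := Ez; rewrite !pt0.
by have /rowP/(_ 1) := Ez; rewrite !pt1.
Qed.

End Imprimitive.

(** The ratio [d / d'] is half the sum of the absolute values of the [l + 1]
    nonzero entries of [g]. That sum is at least [3]: either [l > 1], or there
    are two entries, both divisible by some [m > 1]. *)
Lemma imprimitive_degree_lt (n l d d' : nat) (tau : {fset 'rV[int]_n})
    (pi : 'rV[int]_n -> 'rV[int]_l.+1) (pi' : 'rV[int]_n -> 'rV[int]_2) :
  cayley d tau pi -> imprimitive tau pi -> is_reduction tau pi d' pi' ->
  (d' < d)%N.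
Proof.
move=> cay imp red.
have [g [gB [d'0 g0 sg] [u ut pu] _ piE]] := reduction_coordinates cay red.
have dE : d = (char_height g * d')%N.
  have [sim _ _ _] := cay; rewrite -(simplex_absz (sim u ut)).
  have [k kd [ku uE]] := piE u ut.
  have k0 : k = 0%N by move: ku; rewrite pu => /rowP/(_ 1); rewrite !pt1 => -[].
  rewrite -char_heightE // big_distrl; apply: eq_bigr => i _.
  by rewrite uE k0 subn0 muln0 addn0.
suff e2 : (1 < char_height g)%N by rewrite dE -[X in (X < _)%N]mul1n ltn_pmul2r.
have two : (\sum_i (posp (g 0%R i) + negp (g 0%R i)) = (char_height g).*2)%N.
  by rewrite big_split /= char_heightE // addnn.
have ge c : (forall i, c <= posp (g 0%R i) + negp (g 0%R i))%N ->
    (l.+1 * c <= (char_height g).*2)%N.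
  move=> hc; rewrite -two -[X in (X * c)%N]card_ord -sum_nat_const.
  by apply: leq_sum => i _.
case: imp => [[_ l1]|[l1 [m m1 hm]]].
  have := ge 1%N; rewrite muln1 => h; have : (l.+1 <= (char_height g).*2)%N.
    by apply: h => i; rewrite pospDnegp absz_gt0.
  by lia.
have : (l.+1 * m <= (char_height g).*2)%N.
  apply: ge => i; have := hm g gB i; have := g0 i; rewrite dvdzE /= => gi.
  move=> /dvdn_leq-/(_ _)/leq_trans; apply; first by rewrite absz_gt0.
  by rewrite pospDnegp.
by move: (char_height g) l1 m1; clear; nia.
Qed.

(** Differences of image points are [g] times the corresponding differences of
    the second coordinate of [pi'], and [g] is a combination of them. *)
Lemma reduction_length_one (n l d d' : nat) (tau : {fset 'rV[int]_n})
    (pi : 'rV[int]_n -> 'rV[int]_l.+1) (pi' : 'rV[int]_n -> 'rV[int]_2) (m : nat) :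
  cayley d tau pi -> is_reduction tau pi d' pi' ->
  (forall u v, u \in tau -> v \in tau -> (m%:Z %| (pi' u - pi' v) ord0 1%R)%Z) ->
  m = 1%N.
Proof.
move=> cay red hm.
have [g [[c gE] [_ g0 _] _ _ piE]] := reduction_coordinates cay red.
have [sim _ _ _] := cay.
have key u v i : u \in tau -> v \in tau ->
    (pi u - pi v) 0 i = g 0 i * (pi' u - pi' v) 0 1.
  move=> ut vt; have [k kd [Ek hk]] := piE u ut; have [j jd [Ej hj]] := piE v vt.
  have nat_entry w : w \in tau -> pi w 0 i = (absz (pi w 0%R i))%:Z.
    by move=> /sim[w0 _]; rewrite gez0_abs.
  have -> : (pi' u - pi' v) 0 1 = k%:Z - j%:Z by rewrite !mxE Ek Ej !pt1.
  have -> : (pi u - pi v) 0 i = pi u 0 i - pi v 0 i by rewrite !mxE.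
  rewrite (nat_entry u ut) (nat_entry v vt) hk hj -[in RHS](pospBnegp (g 0 i)) !PoszD !PoszM.
  by rewrite -!subzn //; ring.
have : (g ord0 ord0 * m%:Z %|
    (\sum_(x <- img tau pi) \sum_(y <- img tau pi) (x - y) *~ c x y) ord0 ord0)%Z.
  rewrite summxE big_seq; apply: rpred_sum => x /imfsetP[u /= ut ->].
  rewrite summxE big_seq; apply: rpred_sum => y /imfsetP[v /= vt ->].
  by rewrite mulrz_mxE dvdz_mulr // key // dvdz_mul ?dvdzz // hm.
rewrite -gE -[X in (_ %| X)%Z]mulr1.
rewrite dvdz_mul2l; last exact: g0.
by rewrite dvdzE /= dvdn1 => /eqP.
Qed.

Theorem imprimitive_degree (K : closedFieldType) (charK : [pchar K] =i pred0)
    (n l d d' : nat) (A tau : {fset 'rV[int]_n})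
    (pi : 'rV[int]_n -> 'rV[int]_l.+1) (pi' : 'rV[int]_n -> 'rV[int]_2)
    (f : 'M[K]_(l.+1, 2)) :
  {subset tau <= A} -> cayley d tau pi -> is_reduction tau pi d' pi' ->
  distinct_roots f ->
  (forall f' : 'M[K]_(2, 2), nonzero_forms f' -> distinct_roots f' ->
     forall x, curve A tau pi f x <-> curve A tau pi' f' x) /\
  curve_degree (curve A tau pi f) d'.
Proof.
move=> tauA cay red df.
have [g [gB [d'0 g0 sg] [u ut pu] [v vt pv] piE]] := reduction_coordinates cay red.
have eqC (f' : 'M[K]_(2, 2)) : nonzero_forms f' -> distinct_roots f' ->
    forall x, curve A tau pi f x <-> curve A tau pi' f' x.
  by move=> nz' df' x; exact: (imprimitive_curve g0 sg piE).
split=> //.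
have two (i : 'I_2) : i = 0 \/ i = 1.
  by case: i => [[|[|]]] // ?; [left | right]; apply/val_inj.
pose f' : 'M[K]_(2, 2) := 1%:M.
have fE i y : lform f' i y = y 0 i.
  by case: (two i) => ->; rewrite /lform !mxE /= ?mul1r ?mul0r ?addr0 ?add0r.
have nz' : nonzero_forms f'.
  by move=> i; apply/eqP => /rowP/(_ i); rewrite !mxE eqxx => /eqP; rewrite oner_eq0.
have df' : distinct_roots f'.
  move=> i j ij y y0; rewrite !fE => yi; apply: contraNneq y0 => yj.
  apply/eqP/rowP => k; rewrite mxE.
  by case: (two i) (two j) (two k) ij yi yj => -> [] -> [] ->.
have sim u' : u' \in tau -> in_simplex d' (pi' u').
  move=> /piE[k kd [-> _]]; split=> [i|]; first by case: (two i) => ->; rewrite ?pt0 ?pt1.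
  rewrite !big_ord_recl big_ord0 addr0 (_ : lift ord0 ord0 = 1); last exact/val_inj.
  by rewrite pt0 pt1 -PoszD subnK.
apply: (@curve_degree_ext _ _ _ (curve A tau pi' f')).
  by move=> x; have := eqC f' nz' df' x; tauto.
apply: cayley_curve_degree => //.
  by move=> i; case: (two i) => ->; [exists v | exists u]; rewrite ?pu ?pv ?pt0 ?pt1.
apply: (length_one_injective tauA sim _ _ nz' df').
  by move=> i; case: (two i) => ->; [exists u | exists v]; rewrite ?pu ?pv ?pt0 ?pt1 // eqz_nat -lt0n.
by move=> m; apply: reduction_length_one cay red.
Qed.

Theorem theorem4p1p2 (K : closedFieldType) (charK : [pchar K] =i pred0)
    (n : nat) (A tau : {fset 'rV[int]_n}) (face_tau : is_face A tau)
    (l d : nat) (pi : 'rV[int]_n -> 'rV[int]_l.+1)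
    (cayley_pi : cayley d tau pi) :
  (general_forms (fun f : 'M[K]_(l.+1, 2) =>
     curve_degree (curve A tau pi f) d) <-> primitive tau pi) /\
  (imprimitive tau pi ->
   forall (d' : nat) (pi' : 'rV[int]_n -> 'rV[int]_2),
     is_reduction tau pi d' pi' ->
     general_forms (fun f : 'M[K]_(l.+1, 2) =>
       (forall f' : 'M[K]_(2, 2), nonzero_forms f' -> distinct_roots f' ->
          forall x, curve A tau pi f x <-> curve A tau pi' f' x) /\
       curve_degree (curve A tau pi f) d')).
Proof.
have tauA : {subset tau <= A}.
  by case: face_tau => F [_ h] u /h[].
have imp d' pi' : is_reduction tau pi d' pi' ->
    generic (fun v : 'rV[K]_(l.+1 * 2) =>
      (forall f' : 'M[K]_(2, 2), nonzero_forms f' -> distinct_roots f' ->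
          forall x, curve A tau pi (vec_mx v) x <-> curve A tau pi' f' x) /\
       curve_degree (curve A tau pi (vec_mx v)) d').
  move=> red; apply: generic_imp (generic_distinct_roots K l.+1) => v df.
  exact (imprimitive_degree charK tauA cayley_pi red df).
split; last first.
  by move=> _ d' pi' /imp; apply: generic_imp.
split=> [gd himp|]; last exact: primitive_degree.
have [d' [pi' red]] := reduction_exists cayley_pi himp.
have [v [nz [/(_ nz) deg [_ deg']]]] :=
  generic_exists (generic_and (generic_nonzero_forms K l.+1) (generic_and gd (imp _ _ red))).
have := imprimitive_degree_lt cayley_pi himp red.
suff -> : d = d' by rewrite ltnn.
apply: (curve_degree_unique _ deg deg').
have [u ut _] := cayley_vanish cayley_pi ord0.
by rewrite cardfs_gt0; apply/fset0Pn; exists u; apply: tauA.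
Qed.
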